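(* Let $m\in\mathbb N_0$, $q\in\mathbb C$ with $0<|q|<1$, and $t,a,b,c,\gamma\in\mathbb C\setminus\{0\}$ with $qa,\,qb,\,qc,\,\frac{qab}c,\,\gamma t,\,\sqrt{qab},\,-\sqrt{qab}\notin\{q^{-k}:k\in\mathbb N_0\}$. Then the big $q$-Jacobi polynomials $P_n(x;a,b,c;q)$ satisfy $$\sum_{n=0}^\infty\frac1{(qa)^n}\frac{(qa,qab,\sqrt{q^3ab},-\sqrt{q^3ab};q)_n}{(q,qb,\sqrt{qab},-\sqrt{qab};q)_n}\;{}_3\phi_3\left(q^{-n},\,q^{n+1}ab,\,\gamma;\ qa,\,\frac{qab}c,\,\gamma t;\ q,\frac{qat}c\right)P_n(q^{m+1}a;a,b,c;q)$$ $$=\left(\frac tq\right)^m\frac{(q^2ab,\frac ca,t;q)_\infty\,(\gamma,\frac{qa}c;q)_m}{(qb,qc,\gamma t;q)_\infty\,(qa,\frac{qab}c;q)_m}.$$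
   Context: $\mathbb N_0=\{0,1,2,\dots\}$. $(a;q)_n=\prod_{j=0}^{n-1}(1-aq^j)$ for $n\in\mathbb N_0\cup\{\infty\}$, $(a_1,\dots,a_k;q)_n=\prod_i(a_i;q)_n$, and $${}_r\phi_s(a_1,\dots,a_r;b_1,\dots,b_s;q,w)=\sum_{k\ge0}\frac{(a_1,\dots,a_r;q)_k}{(q,b_1,\dots,b_s;q)_k}\left((-1)^kq^{\binom k2}\right)^{1+s-r}w^k .$$ The big $q$-Jacobi polynomials are $$P_n(x;a,b,c;q)={}_3\phi_2\left(q^{-n},q^{n+1}ab,x;\ qa,qc;\ q,q\right).$$ The square roots enter only through $(w,-w;q)_n=(w^2;q^2)_n$, so their choice is immaterial. *)

(* Defs.v *)
From HB Require Import structures.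
From mathcomp Require Import all_boot all_order all_algebra.
From mathcomp Require Import complex.
From mathcomp Require Import all_classical all_reals all_analysis.

Set Implicit Arguments.
Unset Strict Implicit.
Unset Printing Implicit Defensive.

Import Order.TTheory GRing.Theory Num.Theory.
Import numFieldNormedType.Exports.

Local Open Scope classical_set_scope.
Local Open Scope ring_scope.
Local Open Scope complex_scope.

(* R[i] packaged as a numClosedFieldType: this is what makes the topology
   induced by the modulus (numFieldNormedType) available on it. *)
Definition Cplx (R : realType) : numClosedFieldType := R[i].

Definition qpoch (K : fieldType) (a q : K) (n : nat) : K :=
  \prod_(j < n) (1 - a * q ^+ j).

Definition qpochs (K : fieldType) (s : seq K) (q : K) (n : nat) : K :=
  \prod_(a <- s) qpoch a q n.

Definition qpoch_inf (R : realType) (a q : Cplx R) : Cplx R :=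
  limn (qpoch a q).

Definition qpochs_inf (R : realType) (s : seq (Cplx R)) (q : Cplx R) : Cplx R :=
  \prod_(a <- s) qpoch_inf a q.

(* The exponent 1 + s - r is an integer, possibly negative: [^] below is the
   int-valued power. *)
Definition qhyper_term (K : fieldType) (us ls : seq K) (q w : K) (k : nat) : K :=
  qpochs us q k / qpochs (q :: ls) q k
  * ((-1) ^+ k * q ^+ 'C(k, 2)) ^ (1 + (size ls)%:Z - (size us)%:Z)
  * w ^+ k.

Definition qhyper (R : realType) (us ls : seq (Cplx R)) (q w : Cplx R) : Cplx R :=
  limn (series (qhyper_term us ls q w)).

Definition big_qJacobi (R : realType) (n : nat) (x a b c q : Cplx R) : Cplx R :=
  qhyper [:: q ^- n; q ^+ n.+1 * a * b; x] [:: q * a; q * c] q q.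

(* Main.v *)
Require Import Defs.
From HB Require Import structures.
From mathcomp Require Import all_boot all_order all_algebra.
From mathcomp Require Import complex.
From mathcomp Require Import all_classical all_reals all_analysis.
From mathcomp Require Import ring lra zify.

(** Write [x_m = q^(m+1) a], let [W_n] be the factor of the n-th summand that
    involves neither the [3phi3] nor [P_n], and put
    [phi_k(n) = (q^-n, q^(n+1) a b; q)_k].  The variable [n] enters the [3phi3]
    only through [phi_k(n)], so expanding it reduces the theorem to the moments
    [F(k, m) = sum_n W_n phi_k(n) P_n(x_m)] and to a single sum over [k].

    For [m = 0], [P_n(q a)] is a product by the q-Chu-Vandermonde sum
    ([q_chu_vandermonde], [jacobi_at_qa]).  Since [phi_k(n) = 0] for [n < k], the
    substitution [n = k + j] turns [F(k, 0)] into the very-well-poised [6phi5] sum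
    with one parameter sent to infinity, at [q^k a, q^k b, q^k c]
    ([moment_base], [well_poised_sum]).

    To go from [m] to [m + 1], note that [- phi_1(n)] is the eigenvalue in the
    q-difference equation of [P_n] ([jacobi_qdiff]): at [x_m] the equation
    writes [phi_1(n) P_n(x_m)] in terms of [P_n(x_(m-1))], [P_n(x_m)] and
    [P_n(x_(m+1))].  As [phi_1 phi_k] is a combination of [phi_k] and
    [phi_(k+1)], this gives [F(k, m+1)] from the moments at [m] and [m - 1],
    and the closed form [moment_shape] obeys the same recurrence ([moment]).
    The closed form contains [(q^-k; q)_m], hence is zero for [k < m];
    the remaining sum over [k >= m] is
    [1phi1 (gamma q^m; gamma t q^m; q, t) = (t; q)_oo / (gamma t q^m; q)_oo],
    which is the well-poised sum at [b = 0] ([kernel_sum]).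

    The sums over [n] and [k] may be interchanged for every [t].  Up to geometric
    factors, [P_n(x_m)] is bounded by [|q|^(n^2/2)], the coefficients
    of the [3phi3] by [|q|^(k^2/2)], and [phi_k(n)] by [|q|^(k^2/2 - n k)] when
    [k <= n].  The total exponent
    [n^2/2 - n k + k^2 = n^2/4 + (n/2 - k)^2] is at least [n^2/4], so the double
    series has a Gaussian majorant ([double_bound]) and Tannery's theorem
    ([tannery]) applies.

    The well-poised sum itself is obtained by telescoping: its value at [(b, c)]
    is an explicit multiple of its value at [(q b, q c)]
    ([well_poised_contiguous]), and after [N] steps only the term [n = 0]
    survives as [N] grows. *)

Set Implicit Arguments.
Unset Strict Implicit.
Unset Printing Implicit Defensive.

Import Order.TTheory GRing.Theory Num.Theory.
Import numFieldNormedType.Exports.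

Local Open Scope classical_set_scope.
Local Open Scope ring_scope.

(** * q-Pochhammer symbols and the algebra of big q-Jacobi polynomials *)

Section Pochhammer.
Variables (K : fieldType) (q : K).
Implicit Types (a b c x B C : K) (n k j : nat).

Lemma qpoch0 a : qpoch a q 0 = 1.
Proof. by rewrite /qpoch big_ord0. Qed.

Lemma qpochS a n : qpoch a q n.+1 = qpoch a q n * (1 - a * q ^+ n).
Proof. by rewrite /qpoch big_ord_recr. Qed.

Lemma qpochD a n k : qpoch a q (n + k) = qpoch a q n * qpoch (a * q ^+ n) q k.
Proof.
elim: k => [|k IH]; first by rewrite addn0 qpoch0 mulr1.
by rewrite addnS !qpochS IH exprD !mulrA.
Qed.

Lemma qpochSl a n : qpoch a q n.+1 = (1 - a) * qpoch (a * q) q n.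
Proof. by rewrite -add1n qpochD qpochS qpoch0 mul1r expr0 mulr1 expr1. Qed.

Lemma qpoch_neq0 a n : (forall j, a * q ^+ j != 1) -> qpoch a q n != 0.
Proof.
by move=> h; apply/prodf_neq0 => i _; rewrite subr_eq0 eq_sym.
Qed.

(** This is what makes every series with an upper parameter [q^-n] terminate. *)
Lemma qpoch_qexpV n k : q != 0 -> (n < k)%N -> qpoch (q ^- n) q k = 0.
Proof.
move=> q0 nk; apply/eqP; rewrite /qpoch prodf_seq_eq0; apply/hasP.
exists (Ordinal nk); first by rewrite mem_index_enum.
by rewrite /= mulVf ?expf_neq0 // subrr.
Qed.

(** Pairing a root with its opposite removes the choice of the square root. *)
Lemma qpoch_sqrt z n : qpoch z q n * qpoch (- z) q n = qpoch (z ^+ 2) (q ^+ 2) n.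
Proof.
rewrite /qpoch -big_split; apply: eq_bigr => i _ /=.
by rewrite -exprM mulnC exprM; ring.
Qed.

Lemma qpochs3 x1 x2 x3 n :
  qpochs [:: x1; x2; x3] q n = qpoch x1 q n * qpoch x2 q n * qpoch x3 q n.
Proof. by rewrite /qpochs !big_cons big_nil mulr1 !mulrA. Qed.

(** Induction on [n] with [B] and [C] free.  Replacing [(q^-n; q)_k] by
    [(q^-(n+1); q)_k] changes the sum by a multiple of the same sum at
    [(B q, C q)], so both values on the right-hand side come from the
    induction hypothesis. *)
Lemma q_chu_vandermonde n B C : q != 0 ->
    (forall j, q ^+ j.+1 != 1) -> (forall j, C * q ^+ j != 1) ->
  \sum_(k < n.+1) qpoch (q ^- n) q k * qpoch B q k
     / (qpoch q q k * qpoch C q k) * q ^+ k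
  = (\prod_(j < n) (B - C * q ^+ j)) / qpoch C q n.
Proof.
move=> q0 hq.
have qq k : qpoch q q k != 0.
  by apply: qpoch_neq0 => j; rewrite -exprS.
elim: n B C => [|n IH] B C hC.
  by rewrite big_ord1 big_ord0 !qpoch0 !(mul1r,mulr1,invr1).
have C1 : 1 - C != 0.
  by rewrite subr_eq0 eq_sym; have := hC 0%N; rewrite expr0 mulr1.
have hCq j : C * q * q ^+ j != 1 by rewrite -mulrA -exprS.
(* the Pascal-type relation between consecutive upper parameters *)
have E k : qpoch (q ^- n.+1) q k.+1
    = qpoch (q ^- n) q k.+1 - qpoch (q ^- n) q k * q ^- n.+1 * (1 - q ^+ k.+1).
  rewrite qpochSl qpochS.
  have -> : q ^- n.+1 * q = q ^- n by rewrite exprS; field; rewrite ?expf_neq0 ?q0.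
  rewrite !exprS; field; by rewrite q0 expf_neq0.
have S1 : \sum_(k < n.+2) qpoch (q ^- n) q k * qpoch B q k
     / (qpoch q q k * qpoch C q k) * q ^+ k =
     (\prod_(j < n) (B - C * q ^+ j)) / qpoch C q n.
  by rewrite big_ord_recr /= qpoch_qexpV // !mul0r addr0 IH.
have -> : \sum_(k < n.+2) qpoch (q ^- n.+1) q k * qpoch B q k
     / (qpoch q q k * qpoch C q k) * q ^+ k =
   \sum_(k < n.+2) qpoch (q ^- n) q k * qpoch B q k
     / (qpoch q q k * qpoch C q k) * q ^+ k
   - q ^- n * (1 - B) / (1 - C) * \sum_(k < n.+1) qpoch (q ^- n) q k * qpoch (B * q) q k
     / (qpoch q q k * qpoch (C * q) q k) * q ^+ k.
  rewrite !(big_ord_recl n.+1) /= !qpoch0 -addrA; congr (_ + _).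
  rewrite mulr_sumr -sumrB; apply: eq_bigr => k _.
  rewrite /bump /= add1n E !(qpochSl B) !(qpochSl C) qpochS (qpochS q).
  have := qq k.+1; rewrite qpochS mulf_eq0 negb_or -exprS => /andP[h1 h2].
  have h3 : qpoch (C * q) q k != 0 by exact: qpoch_neq0.
  rewrite !exprS in h2 *.
  field; rewrite ?expf_neq0 ?q0 ?h1 ?h2 ?h3 ?C1 //.
rewrite S1 IH // big_ord_recr /=.
have -> : \prod_(j < n) (B * q - C * q * q ^+ j) = q ^+ n * \prod_(j < n) (B - C * q ^+ j).
  rewrite -[in q ^+ n](card_ord n) -prodr_const -big_split /=.
  by apply: eq_bigr => i _; ring.
have h : qpoch C q n.+1 != 0 by exact: qpoch_neq0.
have h' := h; rewrite qpochSl mulf_eq0 negb_or in h; case/andP: h => _ h.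
rewrite qpochS mulf_eq0 negb_or in h'; case/andP: h' => h1 h2.
have -> : qpoch C q n.+1 = qpoch C q n * (1 - C * q ^+ n) by rewrite qpochS.
have -> : qpoch (C * q) q n = qpoch C q n * (1 - C * q ^+ n) / (1 - C).
  by rewrite -qpochS qpochSl; field.
by field; rewrite ?expf_neq0 ?q0 ?h1 ?h2 ?C1 .
Qed.

(** [P_n(x; a, b, c; q)] as a finite sum over an arbitrary field. *)
Definition jacobi_sum n x a b c : K :=
  \sum_(k < n.+1) qpoch (q ^- n) q k * qpoch (q ^+ n.+1 * a * b) q k * qpoch x q k
     / (qpoch q q k * qpoch (q * a) q k * qpoch (q * c) q k) * q ^+ k.

(** The q-difference operator of the big q-Jacobi polynomials is bidiagonal on
    the basis [(x; q)_k]: it lowers the index by at most one. *)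
Lemma qpoch_qdiff a b c x k (B := a * q * (x - 1) * (b * x - c) / x ^+ 2)
    (D := (x - a * q) * (x - c * q) / x ^+ 2) :
  q != 0 -> x != 0 ->
  B * (qpoch x q k.+1 - qpoch (q * x) q k.+1)
    + D * (qpoch x q k.+1 - qpoch (x / q) q k.+1)
  = (1 - q ^+ k.+1) * ((a * b * q - q ^- k.+1) * qpoch x q k.+1
     + q ^- k.+1 * (1 - q * a * q ^+ k) * (1 - q * c * q ^+ k) * qpoch x q k).
Proof.
move=> q0 x0; rewrite /B /D.
have E : qpoch x q k.+1 = (1 - x) * qpoch (q * x) q k by rewrite qpochSl mulrC mulrC [x * q]mulrC.
have -> : qpoch (x / q) q k.+1 = (1 - x / q) * qpoch x q k.
  by rewrite qpochSl divfK.
(* the factor [x - 1] of [B] supplies the first factor of [(x; q)_(k+1)],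
   which [(q x; q)_k] lacks *)
have -> : a * q * (x - 1) * (b * x - c) / x ^+ 2 * (qpoch x q k.+1 - qpoch (q * x) q k.+1)
   = a * q * (b * x - c) / x * (1 - q ^+ k.+1) * qpoch x q k.+1.
  by rewrite E qpochS !exprS; field.
by rewrite qpochS !exprS; field; rewrite ?expf_neq0 ?q0 ?x0.
Qed.

(** In the basis [(x; q)_k] the operator is bidiagonal, and the quotient of
    consecutive coefficients of [P_n] is such that the shifted contribution of
    index [k + 1] and the diagonal one of index [k] add up to
    [(1 - q^-n)(1 - q^(n+1) a b)] times the coefficient. *)
Lemma jacobi_qdiff n x a b c (B := a * q * (x - 1) * (b * x - c) / x ^+ 2)
    (D := (x - a * q) * (x - c * q) / x ^+ 2) :
  q != 0 -> x != 0 -> (forall j, q ^+ j.+1 != 1) ->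
  (forall j, q * a * q ^+ j != 1) -> (forall j, q * c * q ^+ j != 1) ->
  (1 - q ^- n) * (1 - q ^+ n.+1 * a * b) * jacobi_sum n x a b c
  = B * (jacobi_sum n x a b c - jacobi_sum n (q * x) a b c)
    + D * (jacobi_sum n x a b c - jacobi_sum n (x / q) a b c).
Proof.
move=> q0 x0 hq ha hc.
pose al k := qpoch (q ^- n) q k * qpoch (q ^+ n.+1 * a * b) q k
     / (qpoch q q k * qpoch (q * a) q k * qpoch (q * c) q k) * q ^+ k.
have bqJE y : jacobi_sum n y a b c = \sum_(k < n.+1) al k * qpoch y q k.
  by apply: eq_bigr => k _; rewrite /al; ring.
have al_last : al n.+1 = 0 by rewrite /al qpoch_qexpV // !mul0r.
pose s k := (1 - q ^+ k) * (a * b * q - q ^- k).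
pose r k := (1 - q ^+ k.+1) * q ^- k.+1 * (1 - q * a * q ^+ k) * (1 - q * c * q ^+ k).
pose T k := B * (qpoch x q k - qpoch (q * x) q k) + D * (qpoch x q k - qpoch (x / q) q k).
have T0 : T 0%N = 0 by rewrite /T !qpoch0 !subrr !mulr0 addr0.
have TS k : T k.+1 = s k.+1 * qpoch x q k.+1 + r k * qpoch x q k.
  by rewrite /T qpoch_qdiff // /s /r; ring.
have -> : B * (jacobi_sum n x a b c - jacobi_sum n (q * x) a b c)
    + D * (jacobi_sum n x a b c - jacobi_sum n (x / q) a b c) = \sum_(k < n.+2) al k * T k.
  rewrite big_ord_recr /= al_last mul0r addr0 !bqJE -!sumrB !mulr_sumr -big_split /=.
  by apply: eq_bigr => k _; rewrite /T; ring.
rewrite big_ord_recl T0 mulr0 add0r.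
under eq_bigr => k _ do rewrite lift0 TS mulrDr.
rewrite big_split /=.
have -> : \sum_(k < n.+1) al k.+1 * (s k.+1 * qpoch x q k.+1)
        = \sum_(k < n.+1) al k * (s k * qpoch x q k).
  transitivity (\sum_(k < n.+2) al k * (s k * qpoch x q k)).
    by rewrite [RHS]big_ord_recl /s expr0 subrr !mul0r mulr0 add0r.
  by rewrite big_ord_recr /= al_last !mul0r addr0.
rewrite -big_split bqJE mulr_sumr; apply: eq_bigr => k _ /=.
have qq j : qpoch q q j != 0.
  by apply: qpoch_neq0 => i; rewrite -exprS.
have := qq k.+1; rewrite qpochS mulf_eq0 negb_or -exprS => /andP[h1 h2].
have : qpoch (q * a) q k.+1 != 0 by exact: qpoch_neq0.
rewrite qpochS mulf_eq0 negb_or => /andP[h3 h4].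
have : qpoch (q * c) q k.+1 != 0 by exact: qpoch_neq0.
rewrite qpochS mulf_eq0 negb_or => /andP[h5 h6].
rewrite /al /s /r !qpochS !exprS; rewrite !exprS in h2.
by field; rewrite ?expf_neq0 ?q0 ?h1 ?h2 ?h3 ?h4 ?h5 ?h6.
Qed.

(** The summand of the very-well-poised [6phi5] series with leading parameter
    [A = q a b] and two more parameters [q a] and [q a b / c], the third one
    having been sent to infinity (hence the factor [q^(n(n-1)/2)]).  The usual
    factor [(1 - A q^(2n)) / (1 - A)] is multiplied by [1 - A], because
    shifting [b] may bring [A] to [1]. *)
Definition well_poised a b c n : K :=
  qpoch (q * a * b) q n * (1 - q ^+ (2 * n).+1 * a * b)
  * (qpoch (q * a) q n * qpoch (q * a * b / c) q n)
  / (qpoch q q n * qpoch (q * b) q n * qpoch (q * c) q n)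
  * ((-1) ^+ n * q ^+ 'C(n, 2)) * (c / a) ^+ n.

(** A telescoping certificate: the difference of the two summands is
    [G_(n+1) - G_n], with [G_N] the right-hand side. *)
Lemma well_poised_contiguous a b c N : q != 0 -> a != 0 -> c != 0 ->
  (forall j, q ^+ j.+1 != 1) ->
  (forall j, q * b * q ^+ j != 1) -> (forall j, q * c * q ^+ j != 1) ->
  \sum_(n < N) (well_poised a b c n - (1 - q * a * b) * (1 - c / a) / ((1 - q * b) * (1 - q * c))
     * well_poised a (q * b) (q * c) n)
  = - (1 - q ^+ N) * qpoch (q * a * b) q N * (qpoch (q * a) q N * qpoch (q * a * b / c) q N)
  / (qpoch q q N * qpoch (q * b) q N * qpoch (q * c) q N)
  * ((-1) ^+ N * q ^+ 'C(N, 2)) * (c / a) ^+ N.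
Proof.
move=> q0 a0 c0 hq hb hc.
elim: N => [|N IH]; first by rewrite big_ord0 expr0 subrr oppr0 !mul0r.
rewrite big_ord_recr /= {}IH /well_poised.
have -> : q * a * (q * b) = q * a * b * q by ring.
have -> : q * a * b * q / (q * c) = q * a * b / c by field; rewrite ?q0 ?c0.
have -> : q * (q * b) = q * b * q by ring.
have -> : q * (q * c) = q * c * q by ring.
have b1 : 1 - q * b != 0.
  by rewrite subr_eq0 eq_sym; have := hb 0%N; rewrite expr0 mulr1.
have c1 : 1 - q * c != 0.
  by rewrite subr_eq0 eq_sym; have := hc 0%N; rewrite expr0 mulr1.
have qq j : qpoch q q j != 0.
  by apply: qpoch_neq0 => i; rewrite -exprS.
have := qq N.+1; rewrite qpochS mulf_eq0 negb_or -exprS => /andP[h1 h2].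
have hb' : qpoch (q * b) q N.+1 != 0 by exact: qpoch_neq0.
have hc' : qpoch (q * c) q N.+1 != 0 by exact: qpoch_neq0.
have -> : qpoch (q * b * q) q N = qpoch (q * b) q N.+1 / (1 - q * b).
  by rewrite qpochSl; field.
have -> : qpoch (q * c * q) q N = qpoch (q * c) q N.+1 / (1 - q * c).
  by rewrite qpochSl; field.
set P := qpoch (q * a * b * q) q N.
have -> : (1 - q * a * b) * (1 - c / a) / ((1 - q * b) * (1 - q * c)) *
   (P * (1 - q ^+ (2 * N).+1 * a * (q * b)) *
    (qpoch (q * a) q N * qpoch (q * a * b / c) q N) /
    (qpoch q q N * (qpoch (q * b) q N.+1 / (1 - q * b)) *
     (qpoch (q * c) q N.+1 / (1 - q * c))) * ((-1) ^+ N * q ^+ 'C(N, 2)) *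
    (q * c / a) ^+ N) =
   (1 - c / a) *
   (qpoch (q * a * b) q N.+1 * (1 - q ^+ (2 * N).+1 * a * (q * b)) *
    (qpoch (q * a) q N * qpoch (q * a * b / c) q N) /
    (qpoch q q N * qpoch (q * b) q N.+1 * qpoch (q * c) q N.+1) * ((-1) ^+ N * q ^+ 'C(N, 2)) *
    (q * c / a) ^+ N).
  by rewrite (qpochSl (q * a * b)) -/P; field; rewrite a0 h1 hb' hc' b1 c1.
clear P; move: hb' hc'; rewrite !qpochS !mulf_eq0 !negb_or => /andP[h3 h4] /andP[h5 h6].
rewrite binS bin1 exprD [(-1) ^+ N.+1]exprS [(c / a) ^+ N.+1]exprS.
have -> : (q * c / a) ^+ N = q ^+ N * (c / a) ^+ N by rewrite -exprMn !mulrA.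
have -> : q ^+ (2 * N).+1 = q * (q ^+ N) ^+ 2 by rewrite exprS mulnC exprM.
rewrite !exprS in h2 *.
by field; rewrite ?a0 ?c0 ?h1 ?h2 ?h3 ?h4 ?h5 ?h6.
Qed.

(** The moment [F(k, m)] divided by a constant that depends neither on [k]
    nor on [m]. *)
Definition moment_shape a b c k m : K :=
  qpoch (q ^- k) q m * qpoch (q * a / c) q m
    / (qpoch (q * a) q m * qpoch (q * a * b / c) q m)
  * (qpoch (q * a) q k * qpoch (q * a * b / c) q k * (c / (q * a)) ^+ k).

(** The recurrence that the q-difference equation forces on the moments; at
    [m = 0] the coefficient [D] is zero, so [m.-1] may stand for the missing
    index. *)
Lemma moment_shape_rec a b c k m (x := q ^+ m.+1 * a)
    (B := a * q * (x - 1) * (b * x - c) / x ^+ 2)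
    (D := (x - a * q) * (x - c * q) / x ^+ 2) :
  q != 0 -> a != 0 -> c != 0 ->
  (forall j, q * a * q ^+ j != 1) -> (forall j, q * a * b / c * q ^+ j != 1) ->
  B * (moment_shape a b c k m - moment_shape a b c k m.+1)
    + D * (moment_shape a b c k m - moment_shape a b c k m.-1)
  = q ^- k * (moment_shape a b c k.+1 m
      - (1 - q ^+ k) * (1 - q ^+ k.+1 * a * b) * moment_shape a b c k m).
Proof.
move=> q0 a0 c0 ha hab.
have nz j : (qpoch (q * a) q j != 0) * (1 - q * a * q ^+ j != 0) *
   (qpoch (q * a * b / c) q j != 0) * (1 - q * a * b / c * q ^+ j != 0).
  by rewrite !qpoch_neq0 // !subr_eq0 ![1 == _]eq_sym ha hab.
have qn0 j : q ^+ j != 0 by rewrite expf_neq0.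
have fix_c j : c - q * a * b * q ^+ j != 0.
  have -> : c - q * a * b * q ^+ j = c * (1 - q * a * b / c * q ^+ j) by field.
  by rewrite mulf_neq0 ?nz.
rewrite /B /D /moment_shape {B D}.
case: m @x => [|m] x; rewrite /x {x} /=.
  rewrite !qpochS !qpoch0 !expr0 !expr1 !exprS.
  have := nz 0%N; rewrite !expr0 !mulr1 => -[[[_ h1] _] h2].
  have := fix_c 0%N; rewrite !expr0 !mulr1 => h3.
  by field; rewrite ?q0 ?a0 ?c0 ?qn0 ?h1 ?h2 ?h3 ?oner_neq0.
have -> : qpoch (q ^- k.+1) q m.+1 = (1 - q ^- k.+1) * qpoch (q ^- k) q m.
  rewrite qpochSl; congr (_ * qpoch _ _ _).
  by rewrite exprS; field; rewrite q0 qn0.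
have := fix_c m.+1; rewrite exprS => h1.
have := nz m.+1; rewrite exprS => -[[[_ h2] _] _].
rewrite !qpochS !exprS.
by field; rewrite ?q0 ?a0 ?c0 ?qn0 ?nz ?h1 ?h2 ?fix_c.
Qed.

End Pochhammer.

(** * Weights, the basis phi and the rational identities behind the moments *)

Lemma bin2D k j : 'C(k + j, 2) = ('C(k, 2) + 'C(j, 2) + k * j)%N.
Proof.
elim: k => [|k IH]; first by rewrite add0n bin0n mul0n addn0.
by rewrite addSn !binS !bin1 IH mulSn; lia.
Qed.

Lemma bin2_square k : ('C(k, 2) + 'C(k, 2) + k = k * k)%N.
Proof. by elim: k => [|k IH] //; rewrite binS bin1; lia. Qed.

Section Weights.
Variables (K : fieldType) (q : K).
Implicit Types (a b c x B C : K) (n k j : nat).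
Hypothesis q_neq0 : q != 0.
Hypothesis qexpS : forall j, q ^+ j.+1 != 1.

Let qq j : qpoch q q j != 0.
Proof. by apply: qpoch_neq0 => i; rewrite -exprS. Qed.

(** At [x = q a] the upper parameter [x] cancels the lower parameter [q a] and
    the [3phi2] becomes a summable [2phi1]. *)
Lemma jacobi_at_qa n a b c : c != 0 ->
  (forall j, q * a * q ^+ j != 1) -> (forall j, q * c * q ^+ j != 1) ->
  jacobi_sum q n (q * a) a b c
  = (- c) ^+ n * q ^+ 'C(n.+1, 2) * qpoch (q * a * b / c) q n / qpoch (q * c) q n.
Proof.
move=> c0 ha hc.
have -> : jacobi_sum q n (q * a) a b c = \sum_(k < n.+1) qpoch (q ^- n) q k
    * qpoch (q ^+ n.+1 * a * b) q k / (qpoch q q k * qpoch (q * c) q k) * q ^+ k.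
  apply: eq_bigr => k _; have h1 := qq k.
  have h2 : qpoch (q * a) q k != 0 by exact: qpoch_neq0.
  have h3 : qpoch (q * c) q k != 0 by exact: qpoch_neq0.
  by field; rewrite h1 h2 h3.
rewrite q_chu_vandermonde //; congr (_ / _).
rewrite (reindex_inj rev_ord_inj) /=.
have E (j : 'I_n) : q ^+ n.+1 * a * b - q * c * q ^+ (n - j.+1)
    = (- c) * q ^+ (n - j.+1).+1 * (1 - q * a * b / c * q ^+ j).
  have -> : q ^+ n.+1 = q ^+ (n - j.+1).+1 * q * q ^+ j.
    by rewrite -mulrA -exprS -exprD; congr (_ ^+ _); have := ltn_ord j; lia.
  by rewrite !exprS; field.
under eq_bigr do rewrite E.
rewrite !big_split /= /qpoch; congr (_ * _ * _).
  by rewrite prodr_const card_ord.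
rewrite -(reindex_inj rev_ord_inj (P := predT) (F := fun j : 'I_n => q ^+ j.+1)) /=.
elim: n {E} => [|n IH]; first by rewrite big_ord0 bin_small ?expr0.
by rewrite big_ord_recr /= IH -exprD [in RHS]binS bin1.
Qed.

(** The weights of the expansion, with the quotient of the four symbols in
    square roots already simplified; see [weightE]. *)
Definition weight a b n : K :=
  (q * a) ^- n * (qpoch (q * a) q n * qpoch (q * a * b) q n * (1 - q ^+ (2 * n).+1 * a * b))
  / (qpoch q q n * qpoch (q * b) q n * (1 - q * a * b)).

(** [(sigma, -sigma; q)_n / (rho, -rho; q)_n] is a quotient of two symbols in
    base [q^2] whose parameters differ by the factor [q^2]; it telescopes. *)
Lemma weightE a b rho sigma n :
  rho ^+ 2 = q * a * b -> sigma ^+ 2 = q ^+ 3 * a * b ->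
  (forall j, rho * q ^+ j != 1) -> (forall j, - rho * q ^+ j != 1) ->
  1 / (q * a) ^+ n
      * (qpochs [:: q * a; q * a * b; sigma; - sigma] q n
         / qpochs [:: q; q * b; rho; - rho] q n) = weight a b n.
Proof.
move=> hrho hsigma h1 h2.
have E2 j : 1 - q * a * b * (q ^+ 2) ^+ j = (1 - rho * q ^+ j) * (1 - - rho * q ^+ j).
  by rewrite -hrho -exprM mulnC exprM; ring.
have nz j : 1 - q * a * b * (q ^+ 2) ^+ j != 0.
  by rewrite E2 mulf_neq0 // subr_eq0 eq_sym.
have R j : qpoch (q * a * b) (q ^+ 2) j != 0.
  by apply: qpoch_neq0 => i; rewrite eq_sym -subr_eq0 nz.
have n0 := nz 0%N; rewrite expr0 mulr1 in n0.
have quot : qpoch (q ^+ 3 * a * b) (q ^+ 2) n / qpoch (q * a * b) (q ^+ 2) n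
    = (1 - q ^+ (2 * n).+1 * a * b) / (1 - q * a * b).
  elim: n => [|n IH]; first by rewrite !qpoch0 muln0 expr1 !divff ?oner_neq0.
  rewrite !qpochS invfM mulrACA IH.
  have -> : q ^+ (2 * n).+1 * a * b = q * a * b * (q ^+ 2) ^+ n.
    by rewrite exprS exprM; ring.
  have -> : q ^+ 3 * a * b * (q ^+ 2) ^+ n = q ^+ (2 * n.+1).+1 * a * b.
    by rewrite -exprM mulnS !exprS; ring.
  by field; rewrite nz n0.
have S4 x1 x2 x3 : qpochs [:: x1; x2; x3; - x3] q n
    = qpoch x1 q n * qpoch x2 q n * qpoch (x3 ^+ 2) (q ^+ 2) n.
  by rewrite /qpochs !big_cons big_nil -qpoch_sqrt; ring.
rewrite !S4 hrho hsigma /weight mulrA div1r.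
rewrite -[RHS]mulrA -[LHS]mulrA; congr (_ * _).
by rewrite -!mulf_div quot.
Qed.

Definition phi a b n k : K := qpoch (q ^- n) q k * qpoch (q ^+ n.+1 * a * b) q k.

Lemma phi_small a b n k : (n < k)%N -> phi a b n k = 0.
Proof. by move=> nk; rewrite /phi qpoch_qexpV // mul0r. Qed.

(** [phi_k] is a polynomial in [phi_1] of Newton type, one linear factor being
    added at each step; this is what turns multiplication by the eigenvalue into
    a shift of [k]. *)
Lemma phi1_mul a b n k :
  (1 - q ^- n) * (1 - q ^+ n.+1 * a * b) * phi a b n k
  = q ^- k * (phi a b n k.+1 - (1 - q ^+ k) * (1 - q ^+ k.+1 * a * b) * phi a b n k).
Proof.
rewrite /phi !qpochS !exprS; field.
by rewrite !expf_neq0.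
Qed.

Lemma qpoch_qexpV_shift k j : qpoch (q ^- (k + j)) q k * qpoch q q j
  = (-1) ^+ k * q ^+ 'C(k, 2) / q ^+ (k * (k + j)) * qpoch q q (k + j).
Proof.
elim: k => [|k IH]; first by rewrite qpoch0 mul0n bin0n !expr0 divr1 mulr1.
have e : q ^- (k.+1 + j) * q = q ^- (k + j).
  by rewrite addSn exprS; field; rewrite q_neq0 expf_neq0.
rewrite qpochSl e -[LHS]mulrA IH addSn qpochS binS bin1 exprD [(-1) ^+ k.+1]exprS.
have -> : q ^+ (k.+1 * (k + j).+1) = q ^+ (k * (k + j)) * q ^+ k * q ^+ (k + j).+1.
  by rewrite -!exprD; congr (_ ^+ _); lia.
by rewrite !exprS; field; rewrite !expf_neq0 ?q_neq0.
Qed.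

Lemma qpoch_qexpV_quot k j : qpoch (q ^- (k + j)) q k / qpoch q q (k + j)
  = (-1) ^+ k * q ^+ 'C(k, 2) / q ^+ (k * (k + j)) / qpoch q q j.
Proof.
apply: (mulIf (qq j)); apply: (mulIf (qq (k + j))).
rewrite !mulfVK // -qpoch_qexpV_shift.
by field.
Qed.

(** The terms with [n < k] are zero; setting [n = k + j] merges
    [(q a b; q)_n (q^(n+1) a b; q)_k] into [(q a b; q)_(2k+j)], and the three
    parameters [a, b, c] are all multiplied by [q^k].  The powers of [q] in [k]
    alone cancel because [2 'C(k, 2) + k = k^2]. *)
Lemma moment_term_shift a b c k j : a != 0 -> c != 0 ->
  (forall j, q * a * q ^+ j != 1) -> (forall j, q * b * q ^+ j != 1) ->
  (forall j, q * c * q ^+ j != 1) -> q * a * b != 1 ->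
  weight a b (k + j) * phi a b (k + j) k * jacobi_sum q (k + j) (q * a) a b c
  = qpoch (q * a * b) q (k + k) * qpoch (q * a) q k * qpoch (q * a * b / c) q k
      / (qpoch (q * b) q k * qpoch (q * c) q k * (1 - q * a * b)) * (c / (q * a)) ^+ k
    * well_poised q (a * q ^+ k) (b * q ^+ k) (c * q ^+ k) j.
Proof.
move=> a0 c0 ha hb hc hab.
rewrite jacobi_at_qa // /weight /phi /well_poised.
have qn0 i : q ^+ i != 0 by rewrite expf_neq0.
have b0 i : qpoch (q * b) q i != 0 by exact: qpoch_neq0.
have cc0 i : qpoch (q * c) q i != 0 by exact: qpoch_neq0.
have ab0 : 1 - q * a * b != 0 by rewrite subr_eq0 eq_sym.
have -> : q * (a * q ^+ k) = q * a * q ^+ k by ring.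
have -> : q * (b * q ^+ k) = q * b * q ^+ k by ring.
have -> : q * (c * q ^+ k) = q * c * q ^+ k by ring.
have -> : q * a * q ^+ k * (b * q ^+ k) = q * a * b * q ^+ (k + k) by rewrite exprD; ring.
have -> : q * a * b * q ^+ (k + k) / (c * q ^+ k) = q * a * b / c * q ^+ k.
  by rewrite exprD; field; rewrite c0 qn0.
have -> : c * q ^+ k / (a * q ^+ k) = c / a by field; rewrite a0 qn0.
have -> : q ^+ (2 * j).+1 * (a * q ^+ k) * (b * q ^+ k) = q ^+ (2 * (k + j)).+1 * a * b.
  have -> : q ^+ (2 * (k + j)).+1 = q ^+ (2 * j).+1 * q ^+ k * q ^+ k.
    by rewrite -!exprD; congr (_ ^+ _); lia.
  by ring.
set W := 1 - q ^+ (2 * (k + j)).+1 * a * b.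
have Eab : qpoch (q * a * b) q (k + j) * qpoch (q ^+ (k + j).+1 * a * b) q k
    = qpoch (q * a * b) q (k + k) * qpoch (q * a * b * q ^+ (k + k)) q j.
  rewrite -qpochD; have -> : (k + k + j = k + j + k)%N by lia.
  by rewrite [RHS]qpochD exprS; congr (_ * qpoch _ _ _); ring.
have Eq := qpoch_qexpV_quot k j.
transitivity ((q * a) ^- (k + j) * (qpoch (q * a) q (k + j) * W)
  / (qpoch (q * b) q (k + j) * (1 - q * a * b))
  * (qpoch (q ^- (k + j)) q k / qpoch q q (k + j))
  * (qpoch (q * a * b) q (k + j) * qpoch (q ^+ (k + j).+1 * a * b) q k)
  * ((- c) ^+ (k + j) * q ^+ 'C((k + j).+1, 2) *
      qpoch (q * a * b / c) q (k + j) / qpoch (q * c) q (k + j))).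
  by field; rewrite ?expf_neq0 ?mulf_neq0 // qq b0 cc0 ab0.
rewrite Eq Eab (qpochD _ (q * a) k j) (qpochD _ (q * b) k j) (qpochD _ (q * c) k j)
  (qpochD _ (q * a * b / c) k j).
have h1 := b0 (k + j)%N; rewrite qpochD mulf_eq0 negb_or in h1; case/andP: h1 => h1 h2.
have h3 := cc0 (k + j)%N; rewrite qpochD mulf_eq0 negb_or in h3; case/andP: h3 => h3 h4.
have -> : (- c) ^+ (k + j) = (-1) ^+ k * (-1) ^+ j * c ^+ k * c ^+ j.
  by rewrite exprD -[- c]mulN1r !exprMn; ring.
have -> : q ^+ 'C((k + j).+1, 2) = q ^+ 'C(k, 2) * q ^+ 'C(j, 2) * q ^+ (k * j) * q ^+ (k + j).
  by rewrite binS bin1 bin2D -!exprD.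
have -> : q ^+ (k * (k + j)) = q ^+ 'C(k, 2) * q ^+ 'C(k, 2) * q ^+ k * q ^+ (k * j).
  by rewrite -!exprD; congr (_ ^+ _); rewrite mulnDr -(bin2_square k).
have s1 : (-1) ^+ k * (-1) ^+ k = 1 :> K by rewrite -exprMn mulrNN mulr1 expr1n.
rewrite !expr_div_n !exprMn !(exprD _ k j).
transitivity ((-1) ^+ k * (-1) ^+ k * (qpoch (q * a * b) q (k + k) * qpoch (q * a) q k * qpoch (q * a * b / c) q k /
(qpoch (q * b) q k * qpoch (q * c) q k * (1 - q * a * b)) * (c ^+ k / (q ^+ k * a ^+ k)) *
(qpoch (q * a * b * q ^+ (k + k)) q j * W *
 (qpoch (q * a * q ^+ k) q j * qpoch (q * a * b / c * q ^+ k) q j) /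
 (qpoch q q j * qpoch (q * b * q ^+ k) q j * qpoch (q * c * q ^+ k) q j) *
 ((-1) ^+ j * q ^+ 'C(j, 2)) * (c ^+ j / a ^+ j)))); last by rewrite s1 mul1r !exprD.
set P1 := qpoch (q * a * b * _) _ _; set P2 := qpoch (q * a * b) _ _.
field.
by rewrite ?qn0 ?h1 ?h2 ?h3 ?h4 ?ab0 ?qq ?expf_neq0 ?a0.
Qed.

(** The coefficient of [phi_k(n)] in the [3phi3]; it is independent of [n]. *)
Definition hyper33_coef a b c g t k : K :=
  qpoch g q k / (qpoch q q k * qpoch (q * a) q k * qpoch (q * a * b / c) q k * qpoch (g * t) q k)
  * ((-1) ^+ k * q ^+ 'C(k, 2)) * (q * a * t / c) ^+ k.

(** The symbols in [q a] and [q a b / c] of index [k] cancel between the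
    coefficient and the moment, which leaves a [1phi1] in [gamma q^m]; that is
    the well-poised summand with [b = 0]. *)
Lemma coef_moment_shift a b c g t m l : a != 0 -> c != 0 -> g != 0 ->
  (forall j, q * a * q ^+ j != 1) -> (forall j, q * a * b / c * q ^+ j != 1) ->
  (forall j, g * t * q ^+ j != 1) ->
  hyper33_coef a b c g t (m + l) * moment_shape q a b c (m + l) m
  = (t / q) ^+ m * (qpoch g q m * qpoch (q * a / c) q m)
      / (qpoch (g * t) q m * (qpoch (q * a) q m * qpoch (q * a * b / c) q m))
    * well_poised q (g * q ^+ m / q) 0 (g * t * q ^+ m / q) l.
Proof.
move=> a0 c0 g0 ha hab hg.
rewrite /hyper33_coef /moment_shape /well_poised.
have qn0 i : q ^+ i != 0 by rewrite expf_neq0.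
have A0 i : qpoch (q * a) q i != 0 by exact: qpoch_neq0.
have B0 i : qpoch (q * a * b / c) q i != 0 by exact: qpoch_neq0.
have G0 i : qpoch (g * t) q i != 0 by exact: qpoch_neq0.
have -> : q * (g * q ^+ m / q) = g * q ^+ m by field.
have -> : q * (g * t * q ^+ m / q) = g * t * q ^+ m by field.
have -> : g * t * q ^+ m / q / (g * q ^+ m / q) = t by field; rewrite q_neq0 g0 qn0.
rewrite !mulr0 mul0r subr0 mulr1.
have P0 : qpoch 0 q l = 1 by rewrite /qpoch big1 // => i _; rewrite mul0r subr0.
rewrite P0.
have h1 := G0 (m + l)%N; rewrite qpochD mulf_eq0 negb_or in h1; case/andP: h1 => h1 h2.
transitivity ((qpoch (q ^- (m + l)) q m / qpoch q q (m + l)) * qpoch g q (m + l)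
  * ((-1) ^+ (m + l) * q ^+ 'C(m + l, 2)) * (q * a * t / c * (c / (q * a))) ^+ (m + l)
  * qpoch (q * a / c) q m
  / (qpoch (g * t) q (m + l) * (qpoch (q * a) q m * qpoch (q * a * b / c) q m))).
  by rewrite [in RHS]exprMn; field; rewrite ?A0 ?B0 ?G0 ?qq.
have -> : q * a * t / c * (c / (q * a)) = t by field; rewrite c0 q_neq0 a0.
rewrite qpoch_qexpV_quot (qpochD _ (g * t) m l) (qpochD _ g m l) bin2D.
have -> : q ^+ (m * (m + l)) = q ^+ 'C(m, 2) * q ^+ 'C(m, 2) * q ^+ m * q ^+ (m * l).
  by rewrite -!exprD mulnDr -(bin2_square m).
have s1 : (-1) ^+ m * (-1) ^+ m = 1 :> K by rewrite -exprMn mulrNN mulr1 expr1n.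
rewrite expr_div_n !exprD.
rewrite -[RHS]mul1r -[X in _ = X * _]s1.
by field; rewrite ?qn0 ?A0 ?B0 ?h1 ?h2 ?qq.
Qed.

Lemma coef_moment_small a b c g t m k : (k < m)%N ->
  hyper33_coef a b c g t k * moment_shape q a b c k m = 0.
Proof. by move=> km; rewrite /moment_shape qpoch_qexpV // !mul0r mulr0. Qed.

End Weights.

(** * The modulus on the complex numbers and Tannery's theorem *)

Lemma sum_nat_eq0 (V : nmodType) (m p : nat) (F : nat -> V) :
  (forall i, (m <= i < p)%N -> F i = 0) -> \sum_(m <= i < p) F i = 0.
Proof. by move=> h; rewrite big_nat_cond big1 // => i /andP[/h]. Qed.

Section Modulus.
Variable R : realType.
Implicit Types (z w : Cplx R) (u f g : nat -> Cplx R).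

(** The modulus with values in [R] rather than in the complex numbers, where
    the order is only partial and real estimates are awkward. *)
Definition absC z : R := complex.Re `|z|.

Lemma normCE z : `|z| = (absC z)%:C%C.
Proof. by rewrite /absC normc_def. Qed.

Lemma absC_ge0 z : 0 <= absC z.
Proof. by rewrite -ler0c -normCE normr_ge0. Qed.

Lemma absCM z w : absC (z * w) = absC z * absC w.
Proof. by apply: complexI; rewrite rmorphM -!normCE normrM. Qed.

Lemma absC1 : absC 1 = 1.
Proof. by apply: complexI; rewrite -normCE normr1. Qed.

Lemma absC0 : absC 0 = 0.
Proof. by apply: complexI; rewrite -normCE normr0. Qed.

Lemma absCN z : absC (- z) = absC z.
Proof. by apply: complexI; rewrite -!normCE normrN. Qed.

Lemma absCB z w : absC (z - w) = absC (w - z).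
Proof. by rewrite -absCN opprB. Qed.

Lemma absCD z w : absC (z + w) <= absC z + absC w.
Proof. by rewrite -lecR rmorphD -!normCE ler_normD. Qed.

Lemma absC_distD v z w : absC (z - w) <= absC (z - v) + absC (v - w).
Proof. by apply: le_trans (absCD _ _); rewrite addrA subrK. Qed.

Lemma absCX z n : absC (z ^+ n) = absC z ^+ n.
Proof. by elim: n => [|n IH]; rewrite ?expr0 ?absC1 // !exprS absCM IH. Qed.

Lemma absCV z : absC z^-1 = (absC z)^-1.
Proof. by apply: complexI; rewrite fmorphV -!normCE normfV. Qed.

Lemma absC_eq0 z : (absC z == 0) = (z == 0).
Proof. by rewrite -(inj_eq (@complexI R)) -normCE normr_eq0. Qed.

Lemma absC_gt0 z : (0 < absC z) = (z != 0).
Proof. by rewrite lt_neqAle absC_ge0 andbT eq_sym absC_eq0. Qed.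

Lemma absC_sign n : absC ((-1) ^+ n) = 1.
Proof. by rewrite absCX absCN absC1 expr1n. Qed.

Lemma absC_sum n (F : nat -> Cplx R) :
  absC (\sum_(k < n) F k) <= \sum_(k < n) absC (F k).
Proof.
elim: n => [|n IH]; first by rewrite !big_ord0 absC0.
by rewrite !big_ord_recr (le_trans (absCD _ _)) // lerD2r.
Qed.

Lemma absC_prod n (F : nat -> Cplx R) :
  absC (\prod_(k < n) F k) = \prod_(k < n) absC (F k).
Proof.
elim: n => [|n IH]; first by rewrite !big_ord0 absC1.
by rewrite !big_ord_recr absCM IH.
Qed.

Lemma absC_ge_Re z : `|complex.Re z| <= absC z.
Proof. by rewrite -lecR -normCE normc_ge_Re. Qed.

Lemma absC_ge_Im z : `|complex.Im z| <= absC z.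
Proof.
have <- : absC (z * 'i%C) = absC z.
  by rewrite absCM /absC normc_def /= expr0n expr1n add0r sqrtr1 mulr1.
by rewrite -normrN -ReiNIm absC_ge_Re.
Qed.

Lemma absC_le_ReIm z : absC z <= `|complex.Re z| + `|complex.Im z|.
Proof.
have {1}-> := complexE z; apply: le_trans (absCD _ _) _.
rewrite absCM /absC !normc_def /= !expr0n expr1n !(add0r, addr0) sqrtr1 mul1r.
by rewrite !sqrtr_sqr.
Qed.

Lemma cvg_absC u z : (fun n => absC (u n - z)) @ \oo --> (0 : R) <-> u @ \oo --> z.
Proof.
split=> h.
  apply/cvgrPdist_lt => e e0.
  have er : e = (complex.Re e)%:C%C.
    by rewrite RRe_real // realE ltW.
  have e1 : 0 < complex.Re e by rewrite -ltcR -er.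
  have /cvgrPdist_lt/(_ _ e1) := h; apply: filterS => n.
  by rewrite sub0r normrN ger0_norm ?absC_ge0 // normCE er ltcR absCB.
apply/cvgrPdist_lt => e e0.
have e1 : (0 : Cplx R) < e%:C%C by rewrite ltcR.
have /cvgrPdist_lt/(_ _ e1) := h; apply: filterS => n.
by rewrite sub0r normrN [`|absC _|]ger0_norm ?absC_ge0 // normCE ltcR absCB.
Qed.

Lemma squeeze_absC (u : nat -> Cplx R) z (b : nat -> R) :
  (forall n, absC (u n - z) <= b n) -> b @ \oo --> (0 : R) -> u @ \oo --> z.
Proof.
move=> ub b0; apply/cvg_absC; apply: squeeze_cvgr (cvg_cst 0) b0.
by apply: nearW => n; rewrite absC_ge0 ub.
Qed.

Lemma absC_cvg_le (u : nat -> Cplx R) z (b : R) :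
  (forall n, absC (u n) <= b) -> u @ \oo --> z -> absC z <= b.
Proof.
move=> ub /cvg_absC /cvgrPdist_lt h; apply/ler_addgt0Pr => e /h [N _ /(_ N (leqnn N))] /=.
rewrite sub0r normrN ger0_norm ?absC_ge0 // => h1.
have := absCD (z - u N) (u N); rewrite subrK absCB => h2.
by apply: le_trans h2 _; rewrite addrC lerD // ltW.
Qed.

Lemma cvgC_unique u (x y : Cplx R) :
  u @ \oo --> x -> u @ \oo --> y -> x = y.
Proof. by move=> ux uy; apply: (@norm_cvg_unique _ _ _ _ _ _ ux uy). Qed.

(** The form in which completeness of the complex numbers is used; it follows
    from the real case applied to real and imaginary parts. *)
Lemma abs_cvg_series u (M : nat -> R) :
  (forall n, absC (u n) <= M n) -> cvgn (series M) ->
  exists z, series u @ \oo --> z.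
Proof.
move=> uM cM.
have part (p : Cplx R -> R) : (forall z, `|p z| <= absC z) ->
    cvgn (series (fun n => p (u n))).
  move=> hp; apply: normed_cvg; apply: series_le_cvg cM => n //=.
  - exact: le_trans (absC_ge0 _) (uM n).
  - exact: le_trans (hp _) (uM n).
have /cvg_ex[/= x cx] := part _ absC_ge_Re.
have /cvg_ex[/= y cy] := part _ absC_ge_Im.
exists (x +i* y)%C.
apply: (@squeeze_absC _ _ (fun n => `|series (fun n => complex.Re (u n)) n - x|
   + `|series (fun n => complex.Im (u n)) n - y|)).
  move=> n; apply: le_trans (absC_le_ReIm _) _.
  suff -> : series u n = (series (fun n => complex.Re (u n)) n
     +i* series (fun n => complex.Im (u n)) n)%C by [].
  rewrite /series /=; elim: n => [|n IH]; first by rewrite !big_geq.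
  by rewrite !big_nat_recr //= IH; case: (u n).
have cvg_dist (v : nat -> R) l : v @ \oo --> l -> (fun n => `|v n - l|) @ \oo --> (0 : R).
  by move=> hv; apply/norm_cvg0P; rewrite -(subrr l); apply: cvgB hv _; exact: cvg_cst.
by rewrite -[0]addr0; apply: cvgD; apply: cvg_dist.
Qed.

Lemma series_tail u z (M : nat -> R) (m : R) N :
  (forall n, absC (u n) <= M n) -> series M @ \oo --> m ->
  series u @ \oo --> z -> absC (z - series u N) <= m - series M N.
Proof.
move=> uM cM cu.
have M0 n : 0 <= M n by exact: le_trans (absC_ge0 _) (uM n).
have MS N' : series M N' <= m.
  rewrite -(cvg_lim _ cM) //; apply: nondecreasing_cvgn_le.
    apply/nondecreasing_seqP => n; rewrite /series /= big_nat_recr //= lerDl; exact: M0.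
  by apply/cvg_ex; exists m.
have diff k : absC (series u (k + N)%N - series u N) <= series M (k + N)%N - series M N.
  elim: k => [|k IH]; first by rewrite add0n !subrr absC0.
  rewrite addSn /series /= !big_nat_recr //= !(addrAC _ _ (- _)).
  by apply: le_trans (absCD _ _) _; rewrite lerD.
apply: (@absC_cvg_le (fun k => series u (k + N)%N - series u N)).
  by move=> k; apply: le_trans (diff k) _; rewrite lerD2r.
apply: cvgB; last exact: cvg_cst.
by move: cu; rewrite -(cvg_shiftn N).
Qed.

Lemma cvg_partial_sums (f : nat -> nat -> Cplx R) g N :
  (forall n, (fun k => f k n) @ \oo --> g n) ->
  (fun k => series (f k) N) @ \oo --> series g N.
Proof.
move=> fg; elim: N => [|N IH].
  have -> : (fun k => series (f k) 0%N) = cst (series g 0%N).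
    by apply/funext => k; rewrite /series /= !big_geq.
  exact: cvg_cst.
have -> : (fun k => series (f k) N.+1) = (fun k => series (f k) N) \+ (fun k => f k N).
  by apply/funext => k; rewrite /series /= big_nat_recr.
have -> : series g N.+1 = series g N + g N by rewrite /series /= big_nat_recr.
exact: cvgD IH (fg N).
Qed.

(** Cut all series at an index beyond which the majorant contributes less than
    [e / 3]; the finite parts converge termwise. *)
Theorem tannery (f : nat -> nat -> Cplx R) g (s : nat -> Cplx R) (M : nat -> R) :
  (forall k n, absC (f k n) <= M n) -> cvgn (series M) ->
  (forall n, (fun k => f k n) @ \oo --> g n) ->
  (forall k, series (f k) @ \oo --> s k) ->
  exists z, series g @ \oo --> z /\ s @ \oo --> z.
Proof.
move=> fM cM fg fs.
have gM n : absC (g n) <= M n by exact: absC_cvg_le (fg n).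
have [z gz] := abs_cvg_series gM cM; exists z; split=> //.
move/cvg_ex: cM => [/= m cM].
apply/cvg_absC/cvgrPdist_lt => e e0.
have e3 : 0 < e / 3 by rewrite divr_gt0.
have /cvgrPdist_lt/(_ _ e3) [N _ /(_ N (leqnn N)) /= hN] := cM.
have hN' : m - series M N < e / 3 by exact: le_lt_trans (ler_norm _) hN.
have part : (fun k => series (f k) N) @ \oo --> series g N.
  exact: cvg_partial_sums.
move/cvg_absC/cvgrPdist_lt/(_ _ e3): part; apply: filterS => k.
rewrite !sub0r !normrN !ger0_norm ?absC_ge0 // => hk.
have h1 := series_tail N (fM k) cM (fs k).
have h2 := series_tail N gM cM gz.
have h3 := absC_distD (series (f k) N) (s k) z.
have h4 := absC_distD (series g N) (series (f k) N) z.
rewrite [absC (series g N - z)]absCB in h4.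
by lra.
Qed.

End Modulus.

(** * Estimates for Gaussian series and q-Pochhammer symbols *)

Section RealEstimates.
Variable R : realType.
Implicit Types (r X C : R).

Lemma weierstrass_product (y : nat -> R) n : (forall j, 0 <= y j <= 1) ->
  1 - \sum_(j < n) y j <= \prod_(j < n) (1 - y j) <= 1.
Proof.
move=> hy; elim: n => [|n /andP[IH1 IH2]].
  by rewrite !big_ord0 subr0 lexx.
rewrite !big_ord_recr /=; have /andP[y0 y1] := hy n.
set P := \prod_(_ < n) _ in IH1 IH2 *; set S := \sum_(_ < n) _ in IH1 *.
have P0 : 0 <= P.
  by apply: prodr_ge0 => j _; have /andP[] := hy j; rewrite subr_ge0.
by apply/andP; split; nra.
Qed.

Lemma sum_geometric_le r n : 0 <= r -> r < 1 -> \sum_(j < n) r ^+ j <= (1 - r)^-1.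
Proof.
move=> r0 r1; have h : 0 < 1 - r by rewrite subr_gt0.
rewrite -[leRHS]mul1r ler_pdivlMr // mulrC.
have -> : (1 - r) * \sum_(j < n) r ^+ j = 1 - r ^+ n.
  elim: n => [|n IH]; first by rewrite big_ord0 mulr0 subrr.
  by rewrite big_ord_recr /= mulrDr IH exprS; ring.
by rewrite gerBl exprn_ge0.
Qed.

Lemma expr_small r X e : 0 <= r -> r < 1 -> 0 < e -> exists J, X * r ^+ J <= e.
Proof.
move=> r0 r1 e0.
have : (fun n => X * r ^+ n) @ \oo --> X * 0.
  apply: cvgM; first exact: cvg_cst.
  by apply: cvg_expr; rewrite ger0_norm.
rewrite mulr0 => /cvgrPdist_lt/(_ _ e0) [J _ /(_ J (leqnn J))] /=.
rewrite sub0r normrN => h; exists J; exact: le_trans (ler_norm _) (ltW h).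
Qed.

(** The ratio of consecutive terms, [X r^n], is eventually at most [1]. *)
Lemma gaussian_bounded r X : 0 <= r -> r < 1 -> 0 <= X ->
  exists2 K, 0 <= K & forall n, X ^+ n * r ^+ 'C(n, 2) <= K.
Proof.
move=> r0 r1 X0; have [J hJ] := expr_small X r0 r1 ltr01.
pose Y := Num.max 1 X.
have Y1 : 1 <= Y by rewrite le_max lexx.
have Y0 : 0 <= Y by exact: le_trans Y1.
have small n : (n <= J)%N -> X ^+ n * r ^+ 'C(n, 2) <= Y ^+ J.
  move=> nJ; apply: (@le_trans _ _ (Y ^+ n)); last exact: ler_weXn2l.
  rewrite -[leRHS]mulr1; apply: ler_pM; rewrite ?exprn_ge0 //.
    by apply: lerXn2r; rewrite ?nnegrE // le_max lexx orbT.
  by apply: exprn_ile1 => //; exact: ltW.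
exists (Y ^+ J); first exact: exprn_ge0.
move=> n; have [/small//|/ltnW] := leqP n J.
move=> /subnKC <-; elim: (n - J)%N => [|k IH]; first by rewrite addn0 small.
apply: le_trans IH; rewrite addnS binS bin1 exprS [r ^+ (_ + _)]exprD.
have -> : X * X ^+ (J + k) * (r ^+ 'C(J + k, 2) * r ^+ (J + k)) =
  X ^+ (J + k) * r ^+ 'C(J + k, 2) * (X * r ^+ (J + k)) by ring.
rewrite -[leRHS]mulr1; apply: ler_wpM2l; first by rewrite mulr_ge0 ?exprn_ge0.
apply: le_trans hJ; apply: ler_wpM2l => //.
by rewrite exprD ler_piMr ?exprn_ge0 // exprn_ile1 // ltW.
Qed.

(** Boundedness at [2 X] gives domination by a geometric series of ratio
    [1/2] at [X]. *)
Lemma cvg_gaussian_series r X C : 0 <= r -> r < 1 -> 0 <= X -> 0 <= C ->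
  cvgn (series (fun n => C * X ^+ n * r ^+ 'C(n, 2))).
Proof.
move=> r0 r1 X0 C0.
have [K K0 hK] := gaussian_bounded r0 r1 (mulr_ge0 (ler0n R 2) X0).
apply: (@series_le_cvg _ _ (geometric (C * K) (2^-1))).
- by move=> n; rewrite !mulr_ge0 ?exprn_ge0.
- by move=> n; rewrite /= !mulr_ge0 ?exprn_ge0 ?invr_ge0.
- move=> n /=; rewrite -!mulrA; apply: ler_wpM2l => //.
  by rewrite exprVn ler_pdivlMr ?exprn_gt0 // mulrC mulrA -exprMn hK.
apply: is_cvg_geometric_series; rewrite ger0_norm ?invr_ge0 //; lra.
Qed.

Lemma cvg_gaussian r X C : 0 <= r -> r < 1 -> 0 <= X -> 0 <= C ->
  (fun n => C * X ^+ n * r ^+ 'C(n, 2)) @ \oo --> (0 : R).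
Proof. by move=> *; apply: cvg_series_cvg_0; exact: cvg_gaussian_series. Qed.

End RealEstimates.

Section QPochEstimates.
Variables (R : realType) (q : Cplx R).
Hypothesis q_lt1 : absC q < 1.
Local Notation r := (absC q).
Implicit Types (x : Cplx R) (X : R).

Let r0 : 0 <= r := absC_ge0 q.

(** Both bounds come from the Weierstrass inequality
    [prod (1 - y_j) >= 1 - sum y_j]; for the upper one, use
    [(1 + y)(1 - y) <= 1]. *)
Lemma qpoch_near1 x n : absC x / (1 - r) <= 2^-1 ->
  2^-1 <= absC (qpoch x q n) <= 2.
Proof.
move=> hx; have h1 : 0 < 1 - r by rewrite subr_gt0.
pose y j := absC x * r ^+ j.
have sy k : \sum_(j < k) y j <= 2^-1.
  rewrite -mulr_sumr; apply: le_trans hx; apply: ler_wpM2l; rewrite ?absC_ge0 //.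
  exact: sum_geometric_le.
have y0 j : 0 <= y j by rewrite mulr_ge0 ?exprn_ge0 ?absC_ge0.
have y2 j : y j <= 2^-1.
  apply: le_trans (sy j.+1); rewrite big_ord_recr /= lerDr.
  by apply: sumr_ge0 => i _.
have y1 j : 0 <= y j <= 1 by rewrite y0 (le_trans (y2 j)) //; lra.
have /andP[w1 _] := weierstrass_product n y1.
have {}w1 : 2^-1 <= \prod_(j < n) (1 - y j).
  by apply: le_trans w1; have := sy n; lra.
rewrite /qpoch (absC_prod n (fun j => 1 - x * q ^+ j)).
have E j : absC (x * q ^+ j) = y j by rewrite absCM absCX.
apply/andP; split.
  apply: le_trans w1 _; apply: ler_prod => j _; apply/andP; split.
    by have := y2 j; lra.
  have := absCD (1 - x * q ^+ j) (x * q ^+ j).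
  by rewrite subrK absC1 E lerBlDr.
have up : \prod_(j < n) absC (1 - x * q ^+ j) <= \prod_(j < n) (1 + y j).
  apply: ler_prod => j _; rewrite absC_ge0 /=.
  by apply: le_trans (absCD _ _) _; rewrite absC1 absCN E.
apply: le_trans up _.
have : \prod_(j < n) (1 + y j) * \prod_(j < n) (1 - y j) <= 1.
  rewrite -big_split /=; apply: (@le_trans _ _ (\prod_(j < n) 1)); last by rewrite big1.
  by apply: ler_prod => j _; have h := y2 j; have h' := y0 j; apply/andP; split; nra.
have : 0 <= \prod_(j < n) (1 + y j) by apply: prodr_ge0 => j _; rewrite addr_ge0.
nra.
Qed.

Lemma qpoch_le_expr x n : absC (qpoch x q n) <= (1 + absC x) ^+ n.
Proof.
rewrite /qpoch (absC_prod n (fun j => 1 - x * q ^+ j)).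
rewrite -[X in _ <= _ ^+ X](card_ord n) -prodr_const.
apply: ler_prod => j _; rewrite absC_ge0 /=.
apply: le_trans (absCD _ _) _; rewrite absC1 absCN lerD2l absCM absCX.
by rewrite ler_piMr ?absC_ge0 // exprn_ile1 // ltW.
Qed.

Lemma qpoch_near1_shift X : exists J : nat, forall x n, absC x <= X ->
  2^-1 <= absC (qpoch (x * q ^+ J) q n) <= 2.
Proof.
have h1 : 0 < 1 - r by rewrite subr_gt0.
have e0 : 0 < 2^-1 * (1 - r) by rewrite mulr_gt0 ?invr_gt0.
have [J hJ] := expr_small X r0 q_lt1 e0.
exists J => x n xX; apply: qpoch_near1; rewrite ler_pdivrMr //.
apply: le_trans hJ; rewrite absCM absCX; apply: ler_wpM2r xX; exact: exprn_ge0.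
Qed.

(** The bound depends on [x] only through its modulus, which later allows
    parameters multiplied by arbitrary powers of [q]. *)
Lemma qpoch_bounded X : 0 <= X -> exists2 M, 0 < M & forall x n, absC x <= X ->
  absC (qpoch x q n) <= M.
Proof.
move=> X0; have [J hJ] := qpoch_near1_shift X.
have X1 : 1 <= 1 + X by rewrite lerDl.
have X2 : 0 <= 1 + X by exact: le_trans X1.
have small x n : absC x <= X -> (n <= J)%N -> absC (qpoch x q n) <= (1 + X) ^+ J.
  move=> xX nJ; apply: le_trans (qpoch_le_expr x n) _.
  apply: (@le_trans _ _ ((1 + X) ^+ n)); last exact: ler_weXn2l.
  by apply: lerXn2r; rewrite ?nnegrE ?addr_ge0 ?absC_ge0 // lerD2l.
exists ((1 + X) ^+ J * 2) => [|x n xX].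
  by rewrite mulr_gt0 ?exprn_gt0 // (lt_le_trans ltr01).
have P0 : 0 <= (1 + X) ^+ J by exact: exprn_ge0.
have [nJ|/ltnW/subnKC <-] := leqP n J.
  by apply: le_trans (small x n xX nJ) _; rewrite ler_peMr //; lra.
rewrite qpochD absCM; apply: ler_pM; rewrite ?absC_ge0 ?small //.
by have /andP[] := hJ x (n - J)%N xX.
Qed.

(** Uniformity in the shift [N] matters for the iterated contiguous relation,
    where the denominators are shifted indefinitely. *)
Lemma qpoch_lower x : (forall j, x * q ^+ j != 1) ->
  exists2 d, 0 < d & forall N n, d <= absC (qpoch (x * q ^+ N) q n).
Proof.
move=> hx; have [J hJ] := qpoch_near1_shift (absC x).
have [M M0 hM] := qpoch_bounded (absC_ge0 x).
have PJ : 0 < absC (qpoch x q J) by rewrite absC_gt0 qpoch_neq0.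
pose d := Num.min (absC (qpoch x q J) / M) (absC (qpoch x q J) / 2).
have d0 : 0 < d by rewrite lt_min !divr_gt0.
have shift N : absC (x * q ^+ N) <= absC x.
  by rewrite absCM absCX ler_piMr ?absC_ge0 // exprn_ile1 // ltW.
have low n : d <= absC (qpoch x q n).
  rewrite ge_min; have [/subnKC nJ|/ltnW/subnKC <-] := leqP n J.
    apply/orP; left; rewrite ler_pdivrMr // -{1}nJ qpochD absCM.
    by apply: ler_wpM2l; [exact: absC_ge0 | exact: hM].
  apply/orP; right; rewrite qpochD absCM; apply: ler_wpM2l; first exact: absC_ge0.
  by have /andP[] := hJ x (n - J)%N (lexx _).
exists (d / M) => [|N n]; first exact: divr_gt0.
rewrite ler_pdivrMr //; apply: le_trans (low (N + n)%N) _.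
by rewrite qpochD absCM mulrC; apply: ler_wpM2l; [exact: absC_ge0 | exact: hM].
Qed.

(** The increments [(x; q)_(n+1) - (x; q)_n = - x q^n (x; q)_n] form an
    absolutely convergent series. *)
Lemma cvg_qpoch x : qpoch x q @ \oo --> qpoch_inf x q.
Proof.
have [M M0 hM] := qpoch_bounded (absC_ge0 x).
pose u n := - qpoch x q n * (x * q ^+ n).
have uM n : absC (u n) <= geometric (M * absC x) r n.
  rewrite /= absCM absCN absCM absCX mulrA.
  apply: ler_wpM2r; first exact: exprn_ge0.
  by apply: ler_wpM2r; [exact: absC_ge0 | exact: hM].
have [|z hz] := abs_cvg_series uM.
  by apply: is_cvg_geometric_series; rewrite ger0_norm.
have qE n : qpoch x q n = 1 + series u n.
  elim: n => [|n IH]; first by rewrite qpoch0 /series /= big_geq ?addr0.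
  by rewrite qpochS mulrBr mulr1 {1}IH /series /= big_nat_recr //= addrA /u mulNr.
suff cv : qpoch x q @ \oo --> 1 + z.
  by rewrite /qpoch_inf (cvg_lim _ cv) //; exact: norm_hausdorff.
have -> : qpoch x q = cst 1 \+ series u by apply/funext.
by apply: cvgD hz; exact: cvg_cst.
Qed.

Lemma qpoch_inf_neq0 x : (forall j, x * q ^+ j != 1) -> qpoch_inf x q != 0.
Proof.
move=> /qpoch_lower[d d0 hd]; apply/eqP => E.
have /cvg_absC/cvgrPdist_lt/(_ _ d0) [N _ /(_ N (leqnn N))] /= := @cvg_qpoch x.
rewrite E subr0 sub0r normrN ger0_norm ?absC_ge0 // ltNge.
by have := hd 0%N N; rewrite expr0 mulr1 => ->.
Qed.

Lemma qpoch_infD x n : qpoch_inf x q = qpoch x q n * qpoch_inf (x * q ^+ n) q.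
Proof.
have h := @cvg_qpoch x.
have h2 : qpoch x q n * qpoch (x * q ^+ n) q k @[k --> \oo] -->
  qpoch x q n * qpoch_inf (x * q ^+ n) q.
  by apply: cvgM; [exact: cvg_cst | exact: cvg_qpoch].
apply: (cvgC_unique _ h2).
have -> : (fun k => qpoch x q n * qpoch (x * q ^+ n) q k) = (fun k => qpoch x q (k + n)%N).
  by apply/funext => k; rewrite addnC qpochD.
by move: h; rewrite -(cvg_shiftn n).
Qed.

End QPochEstimates.

(** * The limiting very-well-poised sum *)

Section WellPoised.
Variables (R : realType) (q : Cplx R).
Hypothesis q_neq0 : q != 0.
Hypothesis q_lt1 : absC q < 1.
Local Notation r := (absC q).
Let r0 : 0 <= r := absC_ge0 q.

Lemma qexpS_neq1 j : q ^+ j.+1 != 1.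
Proof.
apply/eqP => h; have : absC (q ^+ j.+1) < 1 by rewrite absCX exprn_ilt1.
by rewrite h absC1 ltxx.
Qed.

Lemma qq_neq1 j : q * q ^+ j != 1.
Proof. by rewrite -exprS qexpS_neq1. Qed.

Lemma absC_shift_le x N : absC (q ^+ N * x) <= absC x.
Proof. by rewrite absCM absCX ler_piMl ?absC_ge0 // exprn_ile1 // ltW. Qed.

Lemma absC_hyper_term (x y z : Cplx R) n :
  absC (x / y * ((-1) ^+ n * q ^+ 'C(n, 2)) * z ^+ n)
  = absC x / absC y * r ^+ 'C(n, 2) * absC z ^+ n.
Proof. by rewrite !absCM absCV absC_sign !absCX mul1r. Qed.

(** A majorant with an extra factor [r^(N n)]: it is uniform in [N], and it also
    shows that each term of positive index tends to zero as [N] grows. *)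
Lemma well_poised_bound a b c : a != 0 -> c != 0 ->
  (forall j, q * b * q ^+ j != 1) -> (forall j, q * c * q ^+ j != 1) ->
  exists C X, [/\ 0 <= C, 0 <= X & forall N n,
    absC (well_poised q a (q ^+ N * b) (q ^+ N * c) n)
      <= C * (X * r ^+ N) ^+ n * r ^+ 'C(n, 2)].
Proof.
move=> a0 c0 hb hc.
have [M1 M10 hM1] := qpoch_bounded q_lt1 (absC_ge0 (q * a * b)).
have [M2 M20 hM2] := qpoch_bounded q_lt1 (absC_ge0 (q * a)).
have [M3 M30 hM3] := qpoch_bounded q_lt1 (absC_ge0 (q * a * b / c)).
have [d1 d10 hd1] := qpoch_lower q_lt1 qq_neq1.
have [d2 d20 hd2] := qpoch_lower q_lt1 hb.
have [d3 d30 hd3] := qpoch_lower q_lt1 hc.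
exists (M1 * (1 + absC (q * a * b)) * (M2 * M3) / (d1 * d2 * d3)), (absC (c / a)).
have p1 : 0 < 1 + absC (q * a * b) by rewrite ltr_pwDl ?absC_ge0.
split=> [||N n]; rewrite ?absC_ge0 //.
  by rewrite !(divr_ge0, mulr_ge0) // ltW.
rewrite /well_poised.
have -> : q * a * (q ^+ N * b) = q ^+ N * (q * a * b) by ring.
have -> : q ^+ N * (q * a * b) / (q ^+ N * c) = q * a * b / c.
  by field; rewrite ?expf_neq0 ?c0.
have -> : q * (q ^+ N * b) = q * b * q ^+ N by ring.
have -> : q * (q ^+ N * c) = q * c * q ^+ N by ring.
have num : absC (qpoch (q ^+ N * (q * a * b)) q n)
    * absC (1 - q ^+ (2 * n).+1 * a * (q ^+ N * b))
    * (absC (qpoch (q * a) q n) * absC (qpoch (q * a * b / c) q n))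
    <= M1 * (1 + absC (q * a * b)) * (M2 * M3).
  rewrite !ler_pM ?mulr_ge0 ?absC_ge0 ?hM1 ?hM2 ?hM3 ?absC_shift_le //.
  have -> : q ^+ (2 * n).+1 * a * (q ^+ N * b) = q ^+ (2 * n + N) * (q * a * b).
    by rewrite exprS exprD; ring.
  by apply: le_trans (absCD _ _) _; rewrite absC1 absCN lerD2l absC_shift_le.
have den : d1 * d2 * d3 <= absC (qpoch q q n) * absC (qpoch (q * b * q ^+ N) q n)
    * absC (qpoch (q * c * q ^+ N) q n).
  have := hd1 0%N n; rewrite expr0 mulr1 => h1.
  by rewrite !ler_pM ?mulr_ge0 // ?ltW.
have -> : q ^+ N * c / a = c / a * q ^+ N by ring.
rewrite absC_hyper_term !absCM absCX -[leRHS]mulrAC.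
apply: ler_wpM2r; first by rewrite exprn_ge0 // !mulr_ge0 ?absC_ge0 ?exprn_ge0.
apply: ler_wpM2r; first exact: exprn_ge0.
apply: ler_pM; rewrite ?invr_ge0 ?mulr_ge0 ?absC_ge0 //.
  by move: num; rewrite !absCM.
have d0 : 0 < d1 * d2 * d3 by rewrite !mulr_gt0.
by rewrite lef_pV2 ?posrE // (lt_le_trans d0 den).
Qed.

Lemma cvg_telescoped_boundary a b c : a != 0 -> c != 0 ->
  (forall j, q * b * q ^+ j != 1) -> (forall j, q * c * q ^+ j != 1) ->
  (fun N => - (1 - q ^+ N) * qpoch (q * a * b) q N * (qpoch (q * a) q N * qpoch (q * a * b / c) q N)
  / (qpoch q q N * qpoch (q * b) q N * qpoch (q * c) q N)
  * ((-1) ^+ N * q ^+ 'C(N, 2)) * (c / a) ^+ N) @ \oo --> (0 : Cplx R).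
Proof.
move=> a0 c0 hb hc.
have [M1 M10 hM1] := qpoch_bounded q_lt1 (absC_ge0 (q * a * b)).
have [M2 M20 hM2] := qpoch_bounded q_lt1 (absC_ge0 (q * a)).
have [M3 M30 hM3] := qpoch_bounded q_lt1 (absC_ge0 (q * a * b / c)).
have [d1 d10 hd1] := qpoch_lower q_lt1 qq_neq1.
have [d2 d20 hd2] := qpoch_lower q_lt1 hb.
have [d3 d30 hd3] := qpoch_lower q_lt1 hc.
have C0 : 0 <= 2 * M1 * (M2 * M3) / (d1 * d2 * d3).
  by rewrite !(divr_ge0, mulr_ge0) // ltW.
apply: squeeze_absC (cvg_gaussian r0 q_lt1 (absC_ge0 (c / a)) C0) => n.
rewrite subr0 absC_hyper_term !absCM -[leRHS]mulrAC.
apply: ler_wpM2r; first by rewrite exprn_ge0 // !mulr_ge0 ?absC_ge0 ?exprn_ge0.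
apply: ler_wpM2r; first exact: exprn_ge0.
apply: ler_pM; rewrite ?invr_ge0 ?mulr_ge0 ?absC_ge0 //.
  rewrite !ler_pM ?mulr_ge0 ?absC_ge0 ?hM1 ?hM2 ?hM3 ?absC_shift_le //.
  rewrite absCN; apply: le_trans (absCD _ _) _; rewrite absC1 absCN absCX.
  by rewrite -[leRHS]/(1 + 1) lerD2l exprn_ile1 // ltW.
have := hd1 0%N n; have := hd2 0%N n; have := hd3 0%N n; rewrite expr0 !mulr1 => h3 h2 h1.
have den : d1 * d2 * d3 <= absC (qpoch q q n) * absC (qpoch (q * b) q n)
    * absC (qpoch (q * c) q n).
  by rewrite !ler_pM ?mulr_ge0 // ?ltW.
have d0 : 0 < d1 * d2 * d3 by rewrite !mulr_gt0.
by rewrite lef_pV2 ?posrE // (lt_le_trans d0 den).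
Qed.

Lemma well_poised_sum_step a b c s : a != 0 -> c != 0 ->
  (forall j, q * b * q ^+ j != 1) -> (forall j, q * c * q ^+ j != 1) ->
  series (well_poised q a (q * b) (q * c)) @ \oo --> s ->
  series (well_poised q a b c) @ \oo -->
    (1 - q * a * b) * (1 - c / a) / ((1 - q * b) * (1 - q * c)) * s.
Proof.
move=> a0 c0 hb hc hs.
set k := _ / _.
have G0 := cvg_telescoped_boundary a0 c0 hb hc.
rewrite -[X in _ --> X]add0r.
have -> : series (well_poised q a b c) = (fun N =>
  (- (1 - q ^+ N) * qpoch (q * a * b) q N * (qpoch (q * a) q N * qpoch (q * a * b / c) q N)
  / (qpoch q q N * qpoch (q * b) q N * qpoch (q * c) q N)
  * ((-1) ^+ N * q ^+ 'C(N, 2)) * (c / a) ^+ N) + k * series (well_poised q a (q * b) (q * c)) N).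
  apply/funext => N; rewrite -(well_poised_contiguous _ q_neq0 a0 c0 qexpS_neq1 hb hc).
  rewrite sumrB -mulr_sumr /series /= !big_mkord subrK //.
by apply: cvgD G0 _; apply: cvgM hs; exact: cvg_cst.
Qed.

(** Iterating the contiguous relation [N] times writes the sum as the product
    of the first [N] factors on the right-hand side by the sum at
    [(q^N b, q^N c)].  By Tannery's theorem the latter tends to [1], the value of
    its term of index zero. *)
Theorem well_poised_sum a b c : a != 0 -> c != 0 ->
  (forall j, q * b * q ^+ j != 1) -> (forall j, q * c * q ^+ j != 1) ->
  series (well_poised q a b c) @ \oo -->
    qpoch_inf (q * a * b) q * qpoch_inf (c / a) q
      / (qpoch_inf (q * b) q * qpoch_inf (q * c) q).
Proof.
move=> a0 c0 hb hc.
have [C [X [C0 X0 hCX]]] := well_poised_bound a0 c0 hb hc.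
have rN N : 0 <= r ^+ N <= 1 by rewrite exprn_ge0 // exprn_ile1 // ltW.
have unif N n : absC (well_poised q a (q ^+ N * b) (q ^+ N * c) n) <= C * X ^+ n * r ^+ 'C(n, 2).
  apply: le_trans (hCX N n) _; apply: ler_wpM2r; first exact: exprn_ge0.
  apply: ler_wpM2l => //; have /andP[h1 h2] := rN N.
  by apply: lerXn2r; rewrite ?nnegrE ?mulr_ge0 // ler_piMr.
have dom := cvg_gaussian_series r0 q_lt1 X0 C0.
have cN N : exists s : Cplx R, series (well_poised q a (q ^+ N * b) (q ^+ N * c)) @ \oo --> s.
  exact: (@abs_cvg_series _ (well_poised q a (q ^+ N * b) (q ^+ N * c)) _ (unif N) dom).
have [s hs] := choice cN.
have shift_neq x N j : (forall i, q * x * q ^+ i != 1) -> q * (q ^+ N * x) * q ^+ j != 1.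
  by move=> h; have := h (N + j)%N; rewrite exprD; congr (_ != 1); ring.
(* the termwise limit as [N] grows *)
pose g n : Cplx R := (n == 0%N)%:R.
have fg n : (fun N => well_poised q a (q ^+ N * b) (q ^+ N * c) n) @ \oo --> g n.
  case: n => [|n].
    have -> : (fun N => well_poised q a (q ^+ N * b) (q ^+ N * c) 0)
        = (fun N => 1 - q ^+ N * (q * a * b)).
      by apply/funext => N; rewrite /well_poised !qpoch0 !expr0 expr1 !mulr1 invr1 !mulr1 mul1r; ring.
    apply: (@squeeze_absC _ _ _ (geometric (absC (q * a * b)) r)) => [N|].
      by rewrite addrAC subrr add0r absCN absCM absCX mulrC.
    by apply: cvg_geometric; rewrite ger0_norm.
  apply: (@squeeze_absC _ _ _ (geometric (C * X ^+ n.+1) r)) => [N|].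
    rewrite subr0; apply: le_trans (hCX N n.+1) _; rewrite /= exprMn mulrA -[leRHS]mulr1.
    have /andP[h1 h2] := rN N.
    apply: ler_pM; rewrite ?mulr_ge0 ?exprn_ge0 //; last first.
      by rewrite exprn_ile1 // ltW.
    apply: ler_wpM2l; first by rewrite mulr_ge0 ?exprn_ge0.
    by rewrite exprS ler_piMr ?exprn_ge0 // exprn_ile1.
  by apply: cvg_geometric; rewrite ger0_norm.
have [z [gz sz]] := @tannery _ (fun N => well_poised q a (q ^+ N * b) (q ^+ N * c)) _ _ _ unif dom fg hs.
have z1 : z = 1.
  have g1 : series g @ \oo --> (1 : Cplx R).
    rewrite -(cvg_shiftn 1); have -> : [sequence series g (n + 1)%N]_n = cst 1.
      by apply/funext => n; rewrite /series /= addn1 big_nat_recl //= big1_seq ?addr0.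
    exact: cvg_cst.
  exact: cvgC_unique gz g1.
have chain N : s 0%N = qpoch (q * a * b) q N * qpoch (c / a) q N
      / (qpoch (q * b) q N * qpoch (q * c) q N) * s N.
  elim: N => [|N IH]; first by rewrite !qpoch0 !mulr1 invr1 !mul1r.
  have nb j : q * (q ^+ N * b) * q ^+ j != 1 by exact: shift_neq.
  have nc j : q * (q ^+ N * c) * q ^+ j != 1 by exact: shift_neq.
  have cN0 : q ^+ N * c != 0 by rewrite mulf_neq0 ?expf_neq0.
  have hsN := hs N.+1; rewrite exprS -!mulrA in hsN.
  have h := well_poised_sum_step a0 cN0 nb nc hsN.
  have E := cvgC_unique (hs N) h.
  rewrite IH E !qpochS.
  have hb1 : qpoch (q * b) q N.+1 != 0 by exact: qpoch_neq0.
  have hc1 : qpoch (q * c) q N.+1 != 0 by exact: qpoch_neq0.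
  rewrite !qpochS !mulf_eq0 !negb_or in hb1 hc1.
  case/andP: hb1 => hb1 hb2; case/andP: hc1 => hc1 hc2.
  have e1 : 1 - q * (q ^+ N * b) = 1 - q * b * q ^+ N by ring.
  have e2 : 1 - q * (q ^+ N * c) = 1 - q * c * q ^+ N by ring.
  rewrite e1 e2.
  field; by rewrite ?a0 ?hb1 ?hb2 ?hc1 ?hc2.
have lim : (fun N => qpoch (q * a * b) q N * qpoch (c / a) q N
      / (qpoch (q * b) q N * qpoch (q * c) q N) * s N) @ \oo -->
    qpoch_inf (q * a * b) q * qpoch_inf (c / a) q
      / (qpoch_inf (q * b) q * qpoch_inf (q * c) q) * z.
  apply: cvgM sz; apply: cvgM; first by apply: cvgM; exact: cvg_qpoch.
  apply: cvgV; first by rewrite mulf_neq0 // qpoch_inf_neq0.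
  by apply: cvgM; exact: cvg_qpoch.
have -> : qpoch_inf (q * a * b) q * qpoch_inf (c / a) q
      / (qpoch_inf (q * b) q * qpoch_inf (q * c) q) = s 0%N.
  rewrite -[LHS]mulr1 -z1; apply: (cvgC_unique lim).
  have -> : (fun N => qpoch (q * a * b) q N * qpoch (c / a) q N
      / (qpoch (q * b) q N * qpoch (q * c) q N) * s N) = cst (s 0%N).
    by apply/funext => N; rewrite -chain.
  exact: cvg_cst.
by have := hs 0%N; rewrite expr0 !mul1r.
Qed.

End WellPoised.

(** * Sequences with Gaussian decay *)

Section GaussianDecay.
Variable R : realType.
Implicit Types (f g : nat -> Cplx R) (r : R) (x : Cplx R).

(** The geometric factor [C X^n] is left unspecified, so that products of
    q-Pochhammer symbols and powers need no bookkeeping; only the base [r] of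
    the quadratic exponent is tracked. *)
Definition gaussian r f := exists C X : R,
  [/\ 0 <= C, 1 <= X & forall n, absC (f n) <= C * X ^+ n * r ^+ 'C(n, 2)].

Lemma gaussianM r1 r2 f g : 0 <= r1 -> 0 <= r2 ->
  gaussian r1 f -> gaussian r2 g -> gaussian (r1 * r2) (fun n => f n * g n).
Proof.
move=> r10 r20 [C1 [X1 [C10 X11 h1]]] [C2 [X2 [C20 X21 h2]]].
exists (C1 * C2), (X1 * X2); split; first exact: mulr_ge0.
  by rewrite -[1]mulr1 ler_pM.
move=> n; rewrite absCM !exprMn.
have -> : C1 * C2 * (X1 ^+ n * X2 ^+ n) * (r1 ^+ 'C(n, 2) * r2 ^+ 'C(n, 2))
  = (C1 * X1 ^+ n * r1 ^+ 'C(n, 2)) * (C2 * X2 ^+ n * r2 ^+ 'C(n, 2)) by ring.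
by apply: ler_pM; rewrite ?absC_ge0.
Qed.

Lemma gaussian_scale r f g : 0 <= r ->
  gaussian 1 f -> gaussian r g -> gaussian r (fun n => f n * g n).
Proof. by move=> r0 hf hg; rewrite -[r]mul1r; apply: gaussianM. Qed.

Lemma gaussianB r f g : 0 <= r ->
  gaussian r f -> gaussian r g -> gaussian r (fun n => f n - g n).
Proof.
move=> r0 [C1 [X1 [C10 X11 h1]]] [C2 [X2 [C20 X21 h2]]].
have X10 : 0 <= X1 by exact: le_trans X11.
have X20 : 0 <= X2 by exact: le_trans X21.
exists (C1 + C2), (X1 * X2); split; first exact: addr_ge0.
  by rewrite -[1]mulr1 ler_pM.
move=> n; apply: le_trans (absCD _ _) _; rewrite absCN mulrDl mulrDl.
apply: lerD; [apply: le_trans (h1 n) _ | apply: le_trans (h2 n) _].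
  apply: ler_wpM2r; rewrite ?exprn_ge0 //; apply: ler_wpM2l => //.
  by apply: lerXn2r; rewrite ?nnegrE ?mulr_ge0 // ler_peMr.
apply: ler_wpM2r; rewrite ?exprn_ge0 //; apply: ler_wpM2l => //.
by apply: lerXn2r; rewrite ?nnegrE ?mulr_ge0 // ler_peMl.
Qed.

Lemma gaussian_bound f (M : R) : (forall n, absC (f n) <= M) -> gaussian 1 f.
Proof.
move=> h; exists (Num.max 0 M), 1; split; rewrite ?le_max ?lexx // => n.
by rewrite !expr1n !mulr1 le_max h orbT.
Qed.

Lemma gaussian_expr x : gaussian 1 (fun n => x ^+ n).
Proof.
exists 1, (Num.max 1 (absC x)); split; rewrite ?ler01 ?le_max ?lexx // => n.
rewrite absCX expr1n mulr1 mul1r; apply: lerXn2r; rewrite ?nnegrE ?absC_ge0 //.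
  by rewrite le_max ler01.
by rewrite le_max lexx orbT.
Qed.

Lemma gaussian_cst x : gaussian 1 (fun=> x).
Proof. exact: (@gaussian_bound _ (absC x)). Qed.

Lemma eq_gaussian r f g : f =1 g -> gaussian r f -> gaussian r g.
Proof.
move=> e [C [X [C0 X1 h]]]; exists C, X; split=> // n; by rewrite -e.
Qed.

End GaussianDecay.

(** * Moments of the big q-Jacobi polynomials *)

Section Moments.
Variables (R : realType) (q a b c : Cplx R).
Hypotheses (q_neq0 : q != 0) (q_lt1 : absC q < 1).
Hypotheses (a_neq0 : a != 0) (c_neq0 : c != 0).
Hypothesis qa_neq : forall j, q * a * q ^+ j != 1.
Hypothesis qb_neq : forall j, q * b * q ^+ j != 1.
Hypothesis qc_neq : forall j, q * c * q ^+ j != 1.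
Hypothesis qabc_neq : forall j, q * a * b / c * q ^+ j != 1.
Hypothesis qab_neq : forall j, q * a * b * q ^+ (j + j) != 1.

Local Notation r := (absC q).
Let r0 : 0 <= r := absC_ge0 q.
Let r_gt0 : 0 < r. Proof. by rewrite absC_gt0. Qed.
Let qq := qexpS_neq1 q_lt1.

(** [P_n] at the point [x_m = q^(m+1) a] of the support of its orthogonality
    measure. *)
Definition jacobi_node m n := jacobi_sum q n (q ^+ m.+1 * a) a b c.

Definition moment_const : Cplx R :=
  qpoch_inf (q ^+ 2 * a * b) q * qpoch_inf (c / a) q
  / (qpoch_inf (q * b) q * qpoch_inf (q * c) q).

(** After the shift [n = k + j] this is [well_poised_sum] at
    [q^k a, q^k b, q^k c]; the infinite products are then brought back to the
    unshifted parameters. *)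
Lemma moment_base k :
  series (fun n => weight q a b n * phi q a b n k * jacobi_node 0 n) @ \oo -->
    moment_const * moment_shape q a b c k 0.
Proof.
have qn0 i : q ^+ i != 0 by rewrite expf_neq0.
have ak0 : a * q ^+ k != 0 by rewrite mulf_neq0.
have ck0 : c * q ^+ k != 0 by rewrite mulf_neq0.
have sh x j : q * (x * q ^+ k) * q ^+ j = q * x * q ^+ (k + j) by rewrite exprD; ring.
have hb j : q * (b * q ^+ k) * q ^+ j != 1 by rewrite sh.
have hc j : q * (c * q ^+ k) * q ^+ j != 1 by rewrite sh.
have ab1 : q * a * b != 1 by have := qab_neq 0; rewrite addn0 expr0 mulr1.
have /= main := well_poised_sum q_neq0 q_lt1 ak0 ck0 hb hc.
pose u n := weight q a b n * phi q a b n k * jacobi_node 0 n.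
suff : series u @ \oo --> moment_const * moment_shape q a b c k 0 by [].
have small : series u k = 0.
  rewrite /series /= sum_nat_eq0 // => i /andP[_ ik].
  by rewrite /u phi_small // mulr0 mul0r.
rewrite -(cvg_shiftn k).
set A := qpoch (q * a * b) q (k + k) * qpoch (q * a) q k * qpoch (q * a * b / c) q k
      / (qpoch (q * b) q k * qpoch (q * c) q k * (1 - q * a * b)) * (c / (q * a)) ^+ k.
have -> : [sequence series u (n + k)%N]_n
    = (fun n => A * series (well_poised q (a * q ^+ k) (b * q ^+ k) (c * q ^+ k)) n).
  apply/funext => n; rewrite /series /= mulr_sumr addnC.
  rewrite (big_cat_nat _ (n := k)) ?leq_addr //=.
  have -> : \sum_(0 <= i < k) u i = 0 by exact: small.
  rewrite add0r -{1}[k]add0n big_addn addKn; apply: eq_bigr => j _.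
  by rewrite /u addnC /jacobi_node expr1 moment_term_shift.
suff -> : moment_const * moment_shape q a b c k 0 = A *
   (qpoch_inf (q * (a * q ^+ k) * (b * q ^+ k)) q *
          qpoch_inf (c * q ^+ k / (a * q ^+ k)) q /
          (qpoch_inf (q * (b * q ^+ k)) q * qpoch_inf (q * (c * q ^+ k)) q)).
  by apply: cvgM main; exact: cvg_cst.
have -> : q * (a * q ^+ k) * (b * q ^+ k) = q * a * b * q ^+ (k + k) by rewrite exprD; ring.
have -> : c * q ^+ k / (a * q ^+ k) = c / a by field; rewrite a_neq0 qn0.
have -> : q * (b * q ^+ k) = q * b * q ^+ k by ring.
have -> : q * (c * q ^+ k) = q * c * q ^+ k by ring.
have n1 : 1 - q * a * b != 0 by rewrite subr_eq0 eq_sym.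
have E1 : (1 - q * a * b) * qpoch_inf (q ^+ 2 * a * b) q
    = qpoch (q * a * b) q (k + k) * qpoch_inf (q * a * b * q ^+ (k + k)) q.
  rewrite -qpoch_infD // (qpoch_infD q_lt1 (q * a * b) 1) qpochS qpoch0 mul1r expr0 mulr1.
  by have -> : q * a * b * q ^+ 1 = q ^+ 2 * a * b by ring.
rewrite /moment_const /moment_shape /A !qpoch0.
rewrite (qpoch_infD q_lt1 (q * b) k) (qpoch_infD q_lt1 (q * c) k).
have b1 : qpoch (q * b) q k != 0 by exact: qpoch_neq0.
have c1 : qpoch (q * c) q k != 0 by exact: qpoch_neq0.
have b2 : qpoch_inf (q * b * q ^+ k) q != 0.
  by apply: qpoch_inf_neq0 => // j; rewrite -mulrA -exprD.
have c2 : qpoch_inf (q * c * q ^+ k) q != 0.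
  by apply: qpoch_inf_neq0 => // j; rewrite -mulrA -exprD.
have -> : qpoch_inf (q ^+ 2 * a * b) q
    = qpoch (q * a * b) q (k + k) * qpoch_inf (q * a * b * q ^+ (k + k)) q / (1 - q * a * b).
  by rewrite -E1; field.
move: b1 c1 b2 c2 n1.
move: (qpoch (q * b) q k) (qpoch (q * c) q k) (qpoch_inf (q * b * q ^+ k) q)
  (qpoch_inf (q * c * q ^+ k) q) (qpoch_inf (c / a) q) (1 - q * a * b)
  (qpoch_inf (q * a * b * q ^+ (k + k)) q) (qpoch (q * a * b) q (k + k))
  (qpoch (q * a) q k) (qpoch (q * a * b / c) q k) ((c / (q * a)) ^+ k)
  (qpoch (q ^- k) q 0) => x1 x2 x3 x4 x5 x6 x7 x8 x9 x10 x11 x12 h1 h2 h3 h4 h5.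
by field; rewrite ?h1 ?h2 ?h3 ?h4 ?h5.
Qed.

Definition qdiffB m : Cplx R := let x := q ^+ m.+1 * a in
  a * q * (x - 1) * (b * x - c) / x ^+ 2.
Definition qdiffD m : Cplx R := let x := q ^+ m.+1 * a in
  (x - a * q) * (x - c * q) / x ^+ 2.

(** The nodes avoid the zeros [1] and [c / b] of [B], so the q-difference
    equation can be solved for the next node. *)
Lemma qdiffB_neq0 m : qdiffB m != 0.
Proof.
have qn0 i : q ^+ i != 0 by rewrite expf_neq0.
rewrite /qdiffB /= !mulf_neq0 ?invr_eq0 ?expf_neq0 ?mulf_neq0 //.
  have -> : q ^+ m.+1 * a = q * a * q ^+ m by rewrite exprS; ring.
  by rewrite subr_eq0.
have -> : b * (q ^+ m.+1 * a) - c = c * (q * a * b / c * q ^+ m - 1).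
  by rewrite exprS; field.
by rewrite mulf_neq0 ?subr_eq0.
Qed.

(** The first node [q a] is a zero of [D]: the recurrence in [m] starts from one
    value only. *)
Lemma qdiffD0 : qdiffD 0 = 0.
Proof. by rewrite /qdiffD /= expr1 [a * q]mulrC subrr !mul0r. Qed.

Lemma jacobi_node_rec m n : jacobi_node m.+1 n = jacobi_node m n - (qdiffB m)^-1 *
  ((1 - q ^- n) * (1 - q ^+ n.+1 * a * b) * jacobi_node m n - qdiffD m * (jacobi_node m n - jacobi_node m.-1 n)).
Proof.
have qn0 i : q ^+ i != 0 by rewrite expf_neq0.
have x0 : q ^+ m.+1 * a != 0 by rewrite mulf_neq0.
have key : (1 - q ^- n) * (1 - q ^+ n.+1 * a * b) * jacobi_node m n
    = qdiffB m * (jacobi_node m n - jacobi_node m.+1 n) + qdiffD m * (jacobi_node m n - jacobi_node m.-1 n).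
  have := jacobi_qdiff n b q_neq0 x0 qq qa_neq qc_neq.
  rewrite -/(qdiffB m) -/(qdiffD m) -/(jacobi_node m n).
  have -> : q * (q ^+ m.+1 * a) = q ^+ m.+2 * a by rewrite [q ^+ m.+2]exprS mulrA.
  rewrite -/(jacobi_node m.+1 n) => ->.
  have -> : qdiffD m * (jacobi_node m n - jacobi_sum q n (q ^+ m.+1 * a / q) a b c)
      = qdiffD m * (jacobi_node m n - jacobi_node m.-1 n).
    case: m {x0} => [|m]; first by rewrite qdiffD0 [LHS]mul0r [RHS]mul0r.
    by have -> : q ^+ m.+2 * a / q = q ^+ m.+1 * a by rewrite [q ^+ m.+2]exprS; field.
  by [].
move: key; move: (jacobi_node m.+1 n) (jacobi_node m n) (jacobi_node m.-1 n) => y1 y0 y ->.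
by rewrite addrK mulKf ?qdiffB_neq0 // subKr.
Qed.

(** Induction on [m] over two consecutive values, for all [k] at once: the
    moment of index [(k, m + 1)] is a combination of moments of index [m] and
    [m - 1], with first index [k] or [k + 1]. *)
Lemma moment m k :
  series (fun n => weight q a b n * phi q a b n k * jacobi_node m n) @ \oo -->
    moment_const * moment_shape q a b c k m.
Proof.
have qn0 i : q ^+ i != 0 by rewrite expf_neq0.
(* the statement for [m] and for [m.-1], which agree at [m = 0] *)
suff H : (forall k, series (fun n => weight q a b n * phi q a b n k * jacobi_node m n) @ \oo -->
    moment_const * moment_shape q a b c k m) /\
    (forall k, series (fun n => weight q a b n * phi q a b n k * jacobi_node m.-1 n) @ \oo -->
    moment_const * moment_shape q a b c k m.-1) by case: H.
elim: m {k} => [|m [IH1 IH2]]; first by split; exact: moment_base.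
split; last exact: IH1.
move=> k.
pose w := fun k m n => weight q a b n * phi q a b n k * jacobi_node m n.
pose e := (1 - q ^+ k) * (1 - q ^+ k.+1 * a * b).
have -> : series (fun n => weight q a b n * phi q a b n k * jacobi_node m.+1 n)
  = (fun N => series (w k m) N - (qdiffB m)^-1 *
      (q ^- k * (series (w k.+1 m) N - e * series (w k m) N)
       - qdiffD m * (series (w k m) N - series (w k m.-1) N))).
  apply/funext => N; rewrite /series /=.
  rewrite !(mulr_sumr, =^~ sumrB); apply: eq_bigr => n _.
  have := phi1_mul q_neq0 a b n k; rewrite -/e => h.
  rewrite jacobi_node_rec /w.
  transitivity (weight q a b n * phi q a b n k * jacobi_node m n - (qdiffB m)^-1 *
     (weight q a b n * ((1 - q ^- n) * (1 - q ^+ n.+1 * a * b) * phi q a b n k) * jacobi_node m n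
      - qdiffD m * (weight q a b n * phi q a b n k * jacobi_node m n
          - weight q a b n * phi q a b n k * jacobi_node m.-1 n))); first by ring.
  by rewrite h; ring.
have -> : moment_const * moment_shape q a b c k m.+1
   = moment_const * moment_shape q a b c k m - (qdiffB m)^-1 *
     (q ^- k * (moment_const * moment_shape q a b c k.+1 m
          - e * (moment_const * moment_shape q a b c k m))
      - qdiffD m * (moment_const * moment_shape q a b c k m
          - moment_const * moment_shape q a b c k m.-1)).
  have := moment_shape_rec k m q_neq0 a_neq0 c_neq0 qa_neq qabc_neq.
  rewrite -/(qdiffB m) -/(qdiffD m) -/e => h.
  have -> : moment_shape q a b c k m.+1 = moment_shape q a b c k m - (qdiffB m)^-1 *
    (q ^- k * (moment_shape q a b c k.+1 m - e * moment_shape q a b c k m)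
     - qdiffD m * (moment_shape q a b c k m - moment_shape q a b c k m.-1)).
    by rewrite -h addrK mulKf ?qdiffB_neq0 //; ring.
  by ring.
apply: cvgB; first exact: IH1.
apply: cvgM; first exact: cvg_cst.
apply: cvgB; (apply: cvgM; first exact: cvg_cst); apply: cvgB.
- exact: IH1.
- by apply: cvgM; [exact: cvg_cst | exact: IH1].
- exact: IH1.
- exact: IH2.
Qed.

Lemma qpoch_gaussian x : gaussian 1 (fun n => qpoch x q n).
Proof.
have [M M0 hM] := qpoch_bounded q_lt1 (absC_ge0 x).
by apply: (@gaussian_bound _ _ M) => n; exact: hM.
Qed.

Lemma qpochV_gaussian x : (forall j, x * q ^+ j != 1) ->
  gaussian 1 (fun n => (qpoch x q n)^-1).
Proof.
move=> hx; have [d d0 hd] := qpoch_lower q_lt1 hx.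
apply: (@gaussian_bound _ _ d^-1) => n; have := hd 0%N n; rewrite expr0 mulr1 => h.
by rewrite absCV lef_pV2 ?posrE // (lt_le_trans d0 h).
Qed.

Lemma affine_qexp_gaussian x i : gaussian 1 (fun n => 1 - q ^+ (i * n).+1 * x).
Proof.
apply: (@gaussian_bound _ _ (1 + absC x)) => n; apply: le_trans (absCD _ _) _.
by rewrite absC1 absCN lerD2l absC_shift_le.
Qed.

Lemma weight_gaussian : gaussian 1 (weight q a b).
Proof.
apply: (@eq_gaussian _ _ (fun n => ((1 - q * a * b)^-1) * ((q * a)^-1 ^+ n
  * (qpoch (q * a) q n * (qpoch (q * a * b) q n * (1 - q ^+ (2 * n).+1 * (a * b))))
  * ((qpoch q q n)^-1 * (qpoch (q * b) q n)^-1)))).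
  by move=> n; rewrite /weight exprVn !invfM; ring.
have one : (0 : R) <= 1 by [].
apply: gaussian_scale => //; first exact: gaussian_cst.
apply: gaussian_scale => //.
  apply: gaussian_scale => //; first exact: gaussian_expr.
  apply: gaussian_scale => //; first exact: qpoch_gaussian.
  apply: gaussian_scale => //; first exact: qpoch_gaussian.
  exact: affine_qexp_gaussian.
by apply: gaussian_scale => //; apply: qpochV_gaussian => // j; exact: qq_neq1.
Qed.

(** The factor [phi_1(n)] of the recurrence is of geometric size, so it does
    not affect the quadratic exponent found at [m = 0]. *)
Lemma jacobi_node_gaussian m : gaussian r (jacobi_node m).
Proof.
have one : (0 : R) <= 1 by [].
suff [] : gaussian r (jacobi_node m) /\ gaussian r (jacobi_node m.-1) by [].
elim: m => [|m [IH1 IH2]].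
  suff h : gaussian r (jacobi_node 0) by split.
  apply: (@eq_gaussian _ _ (fun n => (- c * q) ^+ n * (qpoch (q * a * b / c) q n
     * (qpoch (q * c) q n)^-1) * q ^+ 'C(n, 2))).
    by move=> n; rewrite /jacobi_node expr1 jacobi_at_qa // binS bin1 exprD exprMn; ring.
  apply: gaussian_scale => //; last first.
    by exists 1, 1; split=> // n; rewrite expr1n !mul1r absCX.
  apply: gaussian_scale => //; first exact: gaussian_expr.
  apply: gaussian_scale => //; first exact: qpoch_gaussian.
  exact: qpochV_gaussian.
split; last exact: IH1.
have cst x := @gaussian_cst R x.
apply: (@eq_gaussian _ _ (fun n => jacobi_node m n - (qdiffB m)^-1 *
  (((1 - q^-1 ^+ n) * (1 - q ^+ (1 * n).+1 * (a * b))) * jacobi_node m n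
    - qdiffD m * (jacobi_node m n - jacobi_node m.-1 n)))).
  by move=> n; rewrite jacobi_node_rec mul1n exprVn mulrA.
apply: gaussianB => //; apply: gaussian_scale => //; apply: gaussianB => //.
  apply: gaussian_scale => //; apply: gaussian_scale => //.
    by apply: gaussianB => //; exact: gaussian_expr.
  exact: affine_qexp_gaussian.
by apply: gaussian_scale => //; exact: gaussianB.
Qed.

End Moments.

(** * The sum over k and the main identity *)

Section Terminating.
Variable R : realType.

(** The partial sums are constant from index [n + 1] on. *)
Lemma qhyper_terminating (us ls : seq (Cplx R)) (q w : Cplx R) n :
  (forall k, (n < k)%N -> qhyper_term us ls q w k = 0) ->
  qhyper us ls q w = \sum_(k < n.+1) qhyper_term us ls q w k.
Proof.
move=> h; apply: cvg_lim; first exact: norm_hausdorff.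
rewrite -(cvg_shiftn n.+1).
have -> : [sequence series (qhyper_term us ls q w) (i + n.+1)%N]_i
    = cst (\sum_(k < n.+1) qhyper_term us ls q w k).
  apply/funext => i; rewrite /series /= addnC.
  rewrite (big_cat_nat _ (n := n.+1)) ?leq_addr //= big_mkord.
  by rewrite [X in _ + X]sum_nat_eq0 ?addr0 // => j /andP[nj _]; exact: h.
exact: cvg_cst.
Qed.

Lemma big_qJacobiE n (x a b c q : Cplx R) : q != 0 ->
  big_qJacobi n x a b c q = jacobi_sum q n x a b c.
Proof.
move=> q0; rewrite /big_qJacobi (@qhyper_terminating _ _ _ _ n) => [|k nk].
  apply: eq_bigr => k _; rewrite /qhyper_term !qpochs3 /=.
  have -> : 1 + 2%:Z - 3%:Z = 0 by [].
  by rewrite expr0z mulr1.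
by rewrite /qhyper_term !qpochs3 qpoch_qexpV // !mul0r.
Qed.

Lemma qhyper33E n (q t a b c g : Cplx R) : q != 0 ->
  qhyper [:: q ^- n; q ^+ n.+1 * a * b; g] [:: q * a; q * a * b / c; g * t] q (q * a * t / c)
  = \sum_(k < n.+1) hyper33_coef q a b c g t k * phi q a b n k.
Proof.
move=> q0; have four x1 x2 x3 x4 k : qpochs [:: x1; x2; x3; x4] q k
    = qpoch x1 q k * qpoch x2 q k * qpoch x3 q k * qpoch x4 q k.
  by rewrite /qpochs !big_cons big_nil mulr1 !mulrA.
rewrite (@qhyper_terminating _ _ _ _ n) => [|k nk].
  apply: eq_bigr => k _; rewrite /qhyper_term qpochs3 four /= /hyper33_coef /phi.
  have -> : 1 + 3%:Z - 3%:Z = 1 by [].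
  by rewrite expr1z; ring.
by rewrite /qhyper_term qpochs3 qpoch_qexpV // !mul0r.
Qed.

End Terminating.

Lemma qpochs_inf3 (R : realType) (x y z q : Cplx R) :
  qpochs_inf [:: x; y; z] q = qpoch_inf x q * qpoch_inf y q * qpoch_inf z q.
Proof. by rewrite /qpochs_inf !big_cons big_nil mulr1 mulrA. Qed.

Lemma qpochs2 (K : fieldType) (x y q : K) n :
  qpochs [:: x; y] q n = qpoch x q n * qpoch y q n.
Proof. by rewrite /qpochs !big_cons big_nil mulr1. Qed.

Lemma qpoch_inf0 (R : realType) (q : Cplx R) : qpoch_inf 0 q = 1.
Proof.
apply: cvg_lim; first exact: norm_hausdorff.
have -> : qpoch 0 q = cst 1.
  by apply/funext => n; rewrite /qpoch big1 // => i _; rewrite mul0r subr0.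
exact: cvg_cst.
Qed.

Section Double.
Variables (R : realType) (q a b c g t : Cplx R).
Hypotheses (q_neq0 : q != 0) (q_lt1 : absC q < 1).
Hypotheses (a_neq0 : a != 0) (c_neq0 : c != 0).
Hypotheses (g_neq0 : g != 0) (t_neq0 : t != 0).
Hypothesis qa_neq : forall j, q * a * q ^+ j != 1.
Hypothesis qb_neq : forall j, q * b * q ^+ j != 1.
Hypothesis qc_neq : forall j, q * c * q ^+ j != 1.
Hypothesis qabc_neq : forall j, q * a * b / c * q ^+ j != 1.
Hypothesis qab_neq : forall j, q * a * b * q ^+ (j + j) != 1.
Hypothesis gt_neq : forall j, g * t * q ^+ j != 1.

Local Notation r := (absC q).
Let r0 : 0 <= r := absC_ge0 q.
Let r_gt0 : 0 < r. Proof. by rewrite absC_gt0. Qed.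

Lemma coef_gaussian : gaussian r (hyper33_coef q a b c g t).
Proof.
have one : (0 : R) <= 1 by [].
apply: (@eq_gaussian _ _ (fun k => (qpoch g q k * (((qpoch q q k)^-1 * (qpoch (q * a) q k)^-1)
  * ((qpoch (q * a * b / c) q k)^-1 * (qpoch (g * t) q k)^-1)))
  * ((- (q * a * t / c)) ^+ k * q ^+ 'C(k, 2)))).
  by move=> k; rewrite /hyper33_coef -[- _]mulN1r [(_ * _) ^+ k]exprMn !invfM; ring.
apply: gaussian_scale => //.
  apply: gaussian_scale => //; first exact: qpoch_gaussian.
  by apply: gaussian_scale => //; apply: gaussian_scale => //;
    apply: qpochV_gaussian => // j; exact: qq_neq1.
apply: gaussian_scale => //; first exact: gaussian_expr.
by exists 1, 1; split=> // n; rewrite expr1n !mul1r absCX.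
Qed.

(** By [qpoch_qexpV_shift], [(q^-n; q)_k] is [q^('C(k, 2) - k n)] up to sign and
    a bounded quotient. *)
Lemma phi_bound : exists2 C : R, 0 <= C & forall n k, (k <= n)%N ->
  absC (phi q a b n k) <= C * (r ^+ 'C(k, 2) / r ^+ (k * n)).
Proof.
have [M1 M10 hM1] := qpoch_bounded q_lt1 (absC_ge0 q).
have [M2 M20 hM2] := qpoch_bounded q_lt1 (absC_ge0 (q * a * b)).
have [d d0 hd] := qpoch_lower q_lt1 (qq_neq1 q_lt1).
exists (M1 / d * M2) => [|n k /subnKC <-]; first by rewrite !mulr_ge0 ?invr_ge0 // ltW.
set j := (n - k)%N; rewrite /phi absCM [leRHS]mulrAC.
apply: ler_pM; rewrite ?absC_ge0 //; last first.
  have -> : q ^+ (k + j).+1 * a * b = q ^+ (k + j) * (q * a * b) by rewrite exprS; ring.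
  by apply: hM2; exact: absC_shift_le.
have qj : qpoch q q j != 0 by apply: qpoch_neq0; exact: qq_neq1.
have -> : qpoch (q ^- (k + j)) q k
    = (-1) ^+ k * q ^+ 'C(k, 2) / q ^+ (k * (k + j)) * (qpoch q q (k + j) / qpoch q q j).
  by rewrite mulrA -(qpoch_qexpV_shift q_neq0 k j) mulfK.
rewrite !absCM !absCV absC_sign mul1r !absCX mulrC.
apply: ler_wpM2r; first by rewrite mulr_ge0 ?invr_ge0 ?exprn_ge0.
apply: ler_pM; rewrite ?invr_ge0 ?absC_ge0 ?hM1 //.
have := hd 0%N j; rewrite expr0 mulr1 => h.
by rewrite lef_pV2 ?posrE // (lt_le_trans d0 h).
Qed.

Lemma quartic_root : exists2 u : R, 0 < u < 1 & u ^+ 4 = r.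
Proof.
exists (Num.sqrt (Num.sqrt r)); last first.
  by rewrite (exprM _ 2 2) sqr_sqrtr ?sqrtr_ge0 // sqr_sqrtr.
rewrite !sqrtr_gt0 r_gt0 /=.
have lt1 (x : R) : 0 <= x -> x < 1 -> Num.sqrt x < 1.
  by move=> x0 x1; rewrite -[ltRHS]sqrtr1 ltr_sqrt.
by rewrite !lt1 ?sqrtr_ge0.
Qed.

(** The inequality [n^2/2 - n k + k^2 >= n^2/4], where the quarter is absorbed
    by passing to a fourth root [u] of [r] so that all exponents are natural
    numbers. *)
Lemma exponent_balance u n k : 0 < u < 1 -> u ^+ 4 = r ->
  r ^+ 'C(n, 2) * (r ^+ 'C(k, 2) * r ^+ 'C(k, 2) * r ^+ k) / r ^+ (k * n)
  <= (u ^- 1) ^+ n * (u ^+ 2) ^+ 'C(n, 2).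
Proof.
move=> /andP[u0 u1] ur.
rewrite -!exprD bin2_square.
rewrite -ur -!exprM exprVn.
rewrite ler_pdivrMr ?exprn_gt0 //.
rewrite -mulrA [leRHS]mulrC ler_pdivlMr ?exprn_gt0 // -!exprD.
apply: ler_wiXn2l; rewrite ?ltW //.
have [h1 _] := nat_Cauchy n (2 * k); have h2 := bin2_square n; rewrite -!mulnn in h1; lia.
Qed.

(** A majorant of the double series that does not depend on [k]. *)
Lemma double_bound m : exists C X u : R, [/\ 0 <= C, 0 <= X, 0 < u < 1 &
  forall n k, absC (hyper33_coef q a b c g t k * (weight q a b n * phi q a b n k * jacobi_node q a b c m n))
    <= C * X ^+ n * u ^+ 'C(n, 2)].
Proof.
have [C1 [X1 [C10 X11 h1]]] := coef_gaussian.
have [C2 [X2 [C20 X21 h2]]] := weight_gaussian a q_lt1 qb_neq.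
have [C3 [X3 [C30 X31 h3]]] := jacobi_node_gaussian q_neq0 q_lt1 a_neq0 c_neq0 qa_neq qc_neq qabc_neq m.
have [C4 C40 h4] := phi_bound.
have [u u01 ur] := quartic_root.
have X10 : 0 <= X1 by exact: le_trans X11.
have X20 : 0 <= X2 by exact: le_trans X21.
have X30 : 0 <= X3 by exact: le_trans X31.
have [u0 u1] := andP u01.
exists (C1 * C2 * C3 * C4), (X1 * X2 * X3 / r / u), (u ^+ 2).
split; rewrite ?mulr_ge0 ?invr_ge0 // ?(ltW u0) //.
  by rewrite exprn_gt0 // exprn_ilt1 // ltW.
move=> n k; have [nk|kn] := ltnP n k.
  rewrite phi_small // mulr0 mul0r mulr0 absC0.
  by rewrite !mulr_ge0 ?exprn_ge0 ?mulr_ge0 ?invr_ge0 // ltW.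
have absC4 (x y z w : Cplx R) :
  absC (x * (y * z * w)) = absC x * (absC y * absC z * absC w) by rewrite !absCM.
rewrite absC4.
(* [k <= n] turns the geometric factor in [k] into one in [n]; the factor
   [r^k] is inserted to complete the square [k^2] *)
have hk : absC (hyper33_coef q a b c g t k) <= C1 * (X1 ^+ n / r ^+ n) * (r ^+ 'C(k, 2) * r ^+ k).
  apply: le_trans (h1 k) _; rewrite -!mulrA; apply: ler_wpM2l => //.
  have -> : X1 ^+ n * ((r ^+ n)^-1 * (r ^+ 'C(k, 2) * r ^+ k))
    = X1 ^+ n * (r ^+ 'C(k, 2) * (r ^+ k / r ^+ n)) by ring.
  apply: ler_pM; rewrite ?exprn_ge0 //; first exact: ler_weXn2l.
  rewrite ler_peMr ?exprn_ge0 // ler_pdivlMr ?exprn_gt0 // mul1r.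
  by apply: ler_wiXn2l => //; exact: ltW.
apply: (@le_trans _ _ (C1 * (X1 ^+ n / r ^+ n) * (r ^+ 'C(k, 2) * r ^+ k) *
   (C2 * X2 ^+ n * (C4 * (r ^+ 'C(k, 2) / r ^+ (k * n))) * (C3 * X3 ^+ n * r ^+ 'C(n, 2))))).
  have hw := h2 n; rewrite expr1n mulr1 in hw.
  apply: (ler_pM _ _ hk); rewrite ?mulr_ge0 ?absC_ge0 //.
  apply: (ler_pM _ _ _ (h3 n)); rewrite ?mulr_ge0 ?absC_ge0 //.
  by apply: (ler_pM _ _ hw (h4 n k kn)); rewrite absC_ge0.
have -> : C1 * (X1 ^+ n / r ^+ n) * (r ^+ 'C(k, 2) * r ^+ k) *
   (C2 * X2 ^+ n * (C4 * (r ^+ 'C(k, 2) / r ^+ (k * n))) * (C3 * X3 ^+ n * r ^+ 'C(n, 2)))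
  = C1 * C2 * C3 * C4 * (X1 * X2 * X3 / r) ^+ n *
   (r ^+ 'C(n, 2) * (r ^+ 'C(k, 2) * r ^+ 'C(k, 2) * r ^+ k) / r ^+ (k * n)).
  by rewrite !exprMn exprVn; ring.
have -> : C1 * C2 * C3 * C4 * (X1 * X2 * X3 / r / u) ^+ n * (u ^+ 2) ^+ 'C(n, 2)
  = C1 * C2 * C3 * C4 * (X1 * X2 * X3 / r) ^+ n * ((u ^- 1) ^+ n * (u ^+ 2) ^+ 'C(n, 2)).
  by rewrite [(_ / u) ^+ n]exprMn expr1; ring.
apply: ler_wpM2l; first by rewrite !mulr_ge0 ?exprn_ge0 ?mulr_ge0 ?invr_ge0.
exact: exponent_balance.
Qed.

Definition kernel_value m : Cplx R :=
  (t / q) ^+ m * (qpochs_inf [:: q ^+ 2 * a * b; c / a; t] q * qpochs [:: g; q * a / c] q m)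
      / (qpochs_inf [:: q * b; q * c; g * t] q * qpochs [:: q * a; q * a * b / c] q m).

(** The terms with [k < m] are zero, and the others form a [1phi1] which is
    [well_poised_sum] at [b = 0]. *)
Lemma kernel_sum m :
  series (fun k => hyper33_coef q a b c g t k * (moment_const q a b c * moment_shape q a b c k m))
    @ \oo -->
  kernel_value m.
Proof.
pose u k := hyper33_coef q a b c g t k * (moment_const q a b c * moment_shape q a b c k m).
suff : series u @ \oo --> kernel_value m by [].
have small : series u m = 0.
  rewrite /series /= sum_nat_eq0 // => i /andP[_ ik].
  by rewrite /u mulrCA coef_moment_small // mulr0.
have qn0 i : q ^+ i != 0 by rewrite expf_neq0.
have a'0 : g * q ^+ m / q != 0 by rewrite !mulf_neq0 ?invr_eq0.
have c'0 : g * t * q ^+ m / q != 0 by rewrite !mulf_neq0 ?invr_eq0.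
have E : q * (g * t * q ^+ m / q) = g * t * q ^+ m by field.
have hb j : q * 0 * q ^+ j != 1 :> Cplx R by rewrite mulr0 mul0r eq_sym oner_eq0.
have hc j : q * (g * t * q ^+ m / q) * q ^+ j != 1 by rewrite E -mulrA -exprD.
have main := well_poised_sum q_neq0 q_lt1 a'0 c'0 hb hc.
rewrite -(cvg_shiftn m).
set A := (t / q) ^+ m * (qpoch g q m * qpoch (q * a / c) q m)
      / (qpoch (g * t) q m * (qpoch (q * a) q m * qpoch (q * a * b / c) q m)).
have -> : [sequence series u (n + m)%N]_n
    = (fun n => moment_const q a b c * A * series (well_poised q (g * q ^+ m / q) 0 (g * t * q ^+ m / q)) n).
  apply/funext => n; rewrite /series /= mulr_sumr addnC.
  rewrite (big_cat_nat _ (n := m)) ?leq_addr //=.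
  have -> : \sum_(0 <= i < m) u i = 0 by exact: small.
  rewrite add0r -{1}[m]add0n big_addn addKn; apply: eq_bigr => j _.
  rewrite /u addnC mulrCA coef_moment_shift ?mulrA //; exact: qexpS_neq1.
suff -> : kernel_value m
    = moment_const q a b c * A * (qpoch_inf (q * (g * q ^+ m / q) * 0) q
        * qpoch_inf (g * t * q ^+ m / q / (g * q ^+ m / q)) q
        / (qpoch_inf (q * 0) q * qpoch_inf (q * (g * t * q ^+ m / q)) q)).
  by apply: cvgM main; exact: cvg_cst.
rewrite E !mulr0.
have -> : g * t * q ^+ m / q / (g * q ^+ m / q) = t by field; rewrite q_neq0 g_neq0 qn0.
rewrite /kernel_value /moment_const /A !qpochs_inf3 !qpochs2 qpoch_inf0 mul1r.
rewrite (qpoch_infD q_lt1 (g * t) m).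
have n1 : qpoch_inf (q * b) q != 0 by exact: qpoch_inf_neq0.
have n2 : qpoch_inf (q * c) q != 0 by exact: qpoch_inf_neq0.
have n3 : qpoch_inf (g * t * q ^+ m) q != 0.
  by apply: qpoch_inf_neq0 => // j; rewrite -mulrA -exprD.
have n4 : qpoch (g * t) q m != 0 by exact: qpoch_neq0.
have n5 : qpoch (q * a) q m != 0 by exact: qpoch_neq0.
have n6 : qpoch (q * a * b / c) q m != 0 by exact: qpoch_neq0.
move: n1 n2 n3 n4 n5 n6.
move: (qpoch_inf (q * b) q) (qpoch_inf (q * c) q)
  (qpoch_inf (g * t * q ^+ m) q) (qpoch (g * t) q m) (qpoch (q * a) q m)
  (qpoch (q * a * b / c) q m) (qpoch_inf (q ^+ 2 * a * b) q) (qpoch_inf (c / a) q)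
  (qpoch_inf t q) ((t / q) ^+ m) (qpoch g q m) (qpoch (q * a / c) q m)
  => x1 x2 x3 x4 x5 x6 y1 y2 y3 y4 y5 y6 n1 n2 n3 n4 n5 n6.
by field; rewrite ?n1 ?n2 ?n3 ?n4 ?n5 ?n6.
Qed.

(** Truncate the [3phi3] at [k < K].  The sum over [n] of the truncation is a
    finite combination of moments, and letting [K] grow inside the sum over [n]
    is Tannery's theorem. *)
Lemma jacobi_kernel_sum m :
  series (fun n => weight q a b n
     * (\sum_(k < n.+1) hyper33_coef q a b c g t k * phi q a b n k) * jacobi_node q a b c m n) @ \oo -->
  kernel_value m.
Proof.
have [C [X [u [C0 X0 /andP[u0 u1] hb]]]] := double_bound m.
pose e k n := hyper33_coef q a b c g t k * (weight q a b n * phi q a b n k * jacobi_node q a b c m n).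
pose f K n := \sum_(k < K) e k n.
pose lim k := hyper33_coef q a b c g t k * (moment_const q a b c * moment_shape q a b c k m).
have e_small k n : (n < k)%N -> e k n = 0.
  by move=> nk; rewrite /e phi_small // mulr0 mul0r mulr0.
have f_stable K n : (n < K)%N -> f K n = f n.+1 n.
  rewrite /f -!(big_mkord xpredT (fun k => e k n)) => nK.
  rewrite (big_cat_nat _ (n := n.+1)) //= [X in _ + X]sum_nat_eq0 ?addr0 //.
  by move=> i /andP[ni _]; exact: e_small.
have dom K n : absC (f K n) <= C * (2 * X) ^+ n * u ^+ 'C(n, 2).
  (* at most [n + 1] nonzero terms, and [n + 1 <= 2^n] *)
  have main J : (J <= n.+1)%N -> absC (f J n) <= C * (2 * X) ^+ n * u ^+ 'C(n, 2).
    move=> Jn; apply: le_trans (absC_sum J (fun k => e k n)) _.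
    apply: (@le_trans _ _ (\sum_(k < J) C * X ^+ n * u ^+ 'C(n, 2))).
      by apply: ler_sum => k _; exact: hb.
    have B0 : 0 <= C * X ^+ n * u ^+ 'C(n, 2) by rewrite !mulr_ge0 ?exprn_ge0 // ltW.
    rewrite sumr_const card_ord -[_ *+ J]mulr_natl exprMn.
    have -> : C * (2 ^+ n * X ^+ n) * u ^+ 'C(n, 2) = 2 ^+ n * (C * X ^+ n * u ^+ 'C(n, 2)).
      by ring.
    apply: ler_wpM2r => //; rewrite -natrX ler_nat (leq_trans Jn) //.
    exact: ltn_expl.
  by have [nK|Kn] := ltnP n K; [rewrite f_stable // main | rewrite main // ltnW].
have cdom : cvgn (series (fun n => C * (2 * X) ^+ n * u ^+ 'C(n, 2))).
  by apply: cvg_gaussian_series => //; [exact: ltW | rewrite mulr_ge0].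
have fs K : series (f K) @ \oo --> series lim K.
  elim: K => [|K IH].
    have -> : series (f 0%N) = cst (series lim 0%N).
      by apply/funext => N; rewrite /series /= [RHS]big_geq // big1 // => i _; rewrite /f big_ord0.
    exact: cvg_cst.
  have -> : series (f K.+1) = series (f K) \+ (fun N => hyper33_coef q a b c g t K
     * series (fun n => weight q a b n * phi q a b n K * jacobi_node q a b c m n) N).
    apply/funext => N; rewrite /series /= mulr_sumr -big_split /=; apply: eq_bigr => i _.
    by rewrite /f big_ord_recr.
  have -> : series lim K.+1 = series lim K + lim K by rewrite /series /= big_nat_recr.
  apply: cvgD IH _; apply: cvgM; [exact: cvg_cst | exact: moment].
have fg n : (fun K => f K n) @ \oo --> f n.+1 n.
  rewrite -(cvg_shiftn n.+1).
  have -> : [sequence f (K + n.+1)%N n]_K = cst (f n.+1 n).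
    by apply/funext => K /=; rewrite f_stable // addnS ltnS leq_addl.
  exact: cvg_cst.
have [z [gz sz]] := @tannery _ f (fun n => f n.+1 n) _ _ dom cdom fg fs.
rewrite -(cvgC_unique sz (@kernel_sum m)).
have -> : (fun n => weight q a b n
     * (\sum_(k < n.+1) hyper33_coef q a b c g t k * phi q a b n k) * jacobi_node q a b c m n)
   = (fun n => f n.+1 n).
  apply/funext => n; rewrite /f [weight _ _ _ _ * _]mulr_sumr mulr_suml; apply: eq_bigr => k _.
  by rewrite /e; ring.
exact: gz.
Qed.

End Double.

(* rho and sigma are arbitrary square roots of qab and q^3ab. *)
Theorem theorem8p9 (R : realType) (m : nat)
    (q t a b c gamma rho sigma : Cplx R)
    (q_gt0 : 0 < `|q|) (q_lt1 : `|q| < 1)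
    (t_neq0 : t != 0) (a_neq0 : a != 0) (b_neq0 : b != 0) (c_neq0 : c != 0)
    (gamma_neq0 : gamma != 0)
    (rho_sqrt : rho ^+ 2 = q * a * b)
    (sigma_sqrt : sigma ^+ 2 = q ^+ 3 * a * b)
    (not_qpow : forall k : nat,
       q ^- k \notin
         [:: q * a; q * b; q * c; q * a * b / c; gamma * t; rho; - rho]) :
  series (fun n : nat =>
      1 / (q * a) ^+ n
      * (qpochs [:: q * a; q * a * b; sigma; - sigma] q n
         / qpochs [:: q; q * b; rho; - rho] q n)
      * qhyper [:: q ^- n; q ^+ n.+1 * a * b; gamma]
               [:: q * a; q * a * b / c; gamma * t] q (q * a * t / c)
      * big_qJacobi n (q ^+ m.+1 * a) a b c q) @ \oo
  --> (t / q) ^+ m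
      * (qpochs_inf [:: q ^+ 2 * a * b; c / a; t] q
         * qpochs [:: gamma; q * a / c] q m)
      / (qpochs_inf [:: q * b; q * c; gamma * t] q
         * qpochs [:: q * a; q * a * b / c] q m).
Proof.
have q_neq0 : q != 0 by rewrite -normr_gt0.
have q_lt1' : absC q < 1 by rewrite -ltcR -normCE.
have neq x : (forall k, q ^- k != x) -> forall j, x * q ^+ j != 1.
  move=> h j; apply/eqP => e; have /eqP := h j; apply.
  by apply: (mulIf (expf_neq0 j q_neq0)); rewrite e mulVf ?expf_neq0.

have mem x : x \in [:: q * a; q * b; q * c; q * a * b / c; gamma * t; rho; - rho] ->
    forall j, x * q ^+ j != 1.
  by move=> hx; apply: neq => k; apply: contraNneq (not_qpow k) => ->.
have rho1 j : rho * q ^+ j != 1 by apply: mem; rewrite !inE eqxx ?orbT.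
have rho2 j : - rho * q ^+ j != 1 by apply: mem; rewrite !inE eqxx ?orbT.
have qab_neq j : q * a * b * q ^+ (j + j) != 1.
  have -> : q * a * b * q ^+ (j + j) = (rho * q ^+ j) ^+ 2.
    by rewrite -rho_sqrt exprD; ring.
  by rewrite sqrf_eq1 negb_or rho1 -eqr_oppLR -mulNr rho2.
have -> : (fun n => 1 / (q * a) ^+ n
      * (qpochs [:: q * a; q * a * b; sigma; - sigma] q n
         / qpochs [:: q; q * b; rho; - rho] q n)
      * qhyper [:: q ^- n; q ^+ n.+1 * a * b; gamma]
               [:: q * a; q * a * b / c; gamma * t] q (q * a * t / c)
      * big_qJacobi n (q ^+ m.+1 * a) a b c q)
  = (fun n => weight q a b n
     * (\sum_(k < n.+1) hyper33_coef q a b c gamma t k * phi q a b n k) * jacobi_node q a b c m n).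
  by apply/funext => n; rewrite (weightE n rho_sqrt sigma_sqrt) // qhyper33E // big_qJacobiE.
by apply: jacobi_kernel_sum => //; apply: mem; rewrite !inE eqxx ?orbT.
Qed.
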